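(* For every $\epsilon>0$ there exist constants $C_\epsilon>0$ and $C_0=C_0(\epsilon)>0$ such that the following holds. For every positive integer $N$ and every real $A\ge N^{C_0}$ there exists a set of vectors $V=V_{N,\epsilon}\subset\{z\in\mathbb{Z}^2:\ |z|\approx A\}$ with $|V|=N$, and there exists a (sufficiently large) constant $C_1=C_1(A)$, such that the maximal operator $$A^*_{V}f(x):=\sup_{k\in\mathbb{Z}:\,2^k\ge N^{C_1}}\ \sup_{v\in V}\Big|\sum_{n\in\mathbb{Z}}f(x-nv)\,\phi_k(n)\Big|,\qquad x\in\mathbb{Z}^2,$$ satisfies $$\|A^*_{V}\|_{\ell^2(\mathbb{Z}^2)\to\ell^2(\mathbb{Z}^2)}\le C_\epsilon\,N^{\epsilon}.$$
   Context: Let $\phi$ be a fixed bump function on $\mathbb{R}$ (smooth, compactly supported), and let $\phi_k(t):=2^{-k}\phi(2^{-k}t)$. Constants may depend on $\phi$ (they are uniform over suitably normalized bump functions). The norm $\|T\|_{\ell^2(\mathbb{Z}^2)\to\ell^2(\mathbb{Z}^2)}$ of a sublinear operator $T$ is the least $C$ with $\|Tf\|_{\ell^2(\mathbb{Z}^2)}\le C\|f\|_{\ell^2(\mathbb{Z}^2)}$ for all $f\in\ell^2(\mathbb{Z}^2)$. The notation $|z|\approx A$ means $c_1A\le|z|\le c_2A$ for absolute constants $0<c_1<c_2$ (independent of $\epsilon$, $N$, $A$). The constant $C_1(A)$ may also depend on $\epsilon$. *)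

(* Defs.v *)
From HB Require Import structures.
From mathcomp Require Import all_boot all_order all_algebra finmap.
From mathcomp Require Import complex.
From mathcomp Require Import all_classical all_reals all_analysis.

Set Implicit Arguments.
Unset Strict Implicit.
Unset Printing Implicit Defensive.

Import Order.TTheory GRing.Theory Num.Theory.
Import numFieldNormedType.Exports.

Local Open Scope classical_set_scope.
Local Open Scope ring_scope.

Section Defs.
Variable R : realType.

Definition bump_function (phi : R -> R) : Prop :=
  (forall (m : nat) (t : R), derivable (derive1n m phi) t 1) /\
  compact (closure [set t | phi t != 0]).

Definition dilate (phi : R -> R) (k : int) (t : R) : R :=
  2 ^ (- k) * phi (2 ^ (- k) * t).

Definition euclid_norm (z : int * int) : R :=
  Num.sqrt (z.1%:~R ^+ 2 + z.2%:~R ^+ 2).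

(* The sum over all n in Z is a finitely supported one: for a bump function phi
   only finitely many n satisfy dilate phi k n != 0. Without compact support of
   phi the operator [\sum_(_ \in _)] could take its default value 0. *)
Definition average (phi : R -> R) (k : int) (v : int * int)
    (f : int * int -> R[i]) (x : int * int) : R[i] :=
  \sum_(n \in [set: int])
    f (x - v *~ n) * real_complex R (dilate phi k n%:~R).

Definition maximal_operator (phi : R -> R) (V : {fset int * int}) (r : R)
    (f : int * int -> R[i]) (x : int * int) : \bar R :=
  ereal_sup [set y | exists k v, [/\ r <= 2 ^ k, v \in V &
    y = (ComplexField.Normc.normc (average phi k v f x))%:E]].

Definition l2norm (F : int * int -> \bar R) : \bar R :=
  sqrte (\esum_(x in [set: int * int]) (`|F x| ^+ 2)%E).

Definition l2normC (f : int * int -> R[i]) : \bar R :=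
  l2norm (fun x => (ComplexField.Normc.normc (f x))%:E).

(* Equal to +oo when no admissible constant exists. *)
Definition l2_opnorm
    (T : (int * int -> R[i]) -> int * int -> \bar R) : \bar R :=
  ereal_inf [set C%:E | C in [set C : R | 0 <= C /\
    forall f, (l2normC f < +oo)%E -> (l2norm (T f) <= C%:E * l2normC f)%E]].

End Defs.

(* Main.v *)
(* The vectors can be taken collinear: for [N >= 2], [V] consists of the
   [(g u_i, 0)] with [u_1, ..., u_N] distinct primes in [[U, 2U]], where
   [U <= N^26] and [g ~ A / U].  At scales much longer than any length determined by the [u_i],
   averaging along [g u_i] resembles the projection onto the functions
   invariant under [g u_i]; as the [u_i] are pairwise coprime, these projections
   are mutually orthogonal apart from their common part, the projection onto
   the functions invariant under [g].  The common part is controlled by a single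
   one-dimensional Hardy-Littlewood maximal function and the remainder by a
   square function, so the norm is bounded even without the factor [N^eps].

   The estimates are proved on finite abelian groups and transferred to the
   plane.  The primes come from [2^n <= 'C(2n, n) <= (2n)^(pi(2n))] and the
   pigeonhole principle on dyadic intervals. *)

Require Import Defs.
From HB Require Import structures.
From mathcomp Require Import all_boot all_order all_algebra finmap.
From mathcomp Require Import complex.
From mathcomp Require Import all_classical all_reals all_analysis.
From mathcomp Require Import ring lra zify.

Set Implicit Arguments.
Unset Strict Implicit.
Unset Printing Implicit Defensive.

Import Order.TTheory GRing.Theory Num.Theory.
Import numFieldNormedType.Exports.

Local Open Scope classical_set_scope.
Local Open Scope ring_scope.

(** The index [i] stands for the integer [i - rho k] in the window [[-rho k, rho k)], so a two-sided
    average is written with natural multiples of [m]. *)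
Definition wavg (R : realType) (G : zmodType) (rho : nat -> nat)
    (wt : nat -> nat -> R) (m : G) (k : nat) (f : G -> R) (x : G) : R :=
  \sum_(i < 2 * rho k) wt k i * f (x + m *+ rho k - m *+ i).

(** * Energies and convolutions on a finite abelian group *)

Section FiniteGroup.
Variables (R : realType) (G : finZmodType).
Implicit Types (f h w : G -> R) (x y g m : G).

Definition energy f : R := \sum_x f x ^+ 2.

Lemma energy_ge0 f : 0 <= energy f.
Proof. by apply: sumr_ge0 => x _; exact: sqr_ge0. Qed.

Lemma sum_cauchy_schwarz (I : finType) (a b : I -> R) :
  (\sum_i a i * b i) ^+ 2 <= (\sum_i a i ^+ 2) * (\sum_i b i ^+ 2).
Proof.
have : 0 <= \sum_i \sum_j (a i * b j - a j * b i) ^+ 2.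
  by apply: sumr_ge0 => i _; apply: sumr_ge0 => j _; exact: sqr_ge0.
have -> : \sum_i \sum_j (a i * b j - a j * b i) ^+ 2 =
    2 * ((\sum_i a i ^+ 2) * (\sum_i b i ^+ 2)) - 2 * (\sum_i a i * b i) ^+ 2.
  rewrite expr2 !big_distrlr /= [2 * _ - _](_ : _ =
    \sum_i \sum_j a i ^+ 2 * b j ^+ 2 + \sum_i \sum_j a j ^+ 2 * b i ^+ 2 -
    2 * \sum_i \sum_j a i * b i * (a j * b j)); last first.
    by rewrite [X in _ + X - _]exchange_big /=; ring.
  rewrite mulr_sumr -big_split -sumrB; apply: eq_bigr => i _.
  rewrite mulr_sumr -big_split -sumrB; apply: eq_bigr => j _ /=; ring.
by rewrite subr_ge0 ler_pM2l.
Qed.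

(** Cauchy-Schwarz with [|c i|] split into two square roots; the sign of [c i] goes to [a i]. *)
Lemma sqr_weighted_sum (I : finType) (c a : I -> R) :
  (\sum_i c i * a i) ^+ 2 <= (\sum_i `|c i|) * (\sum_i `|c i| * a i ^+ 2).
Proof.
pose u i := Num.sqrt `|c i|.
have uE i : u i ^+ 2 = `|c i| by rewrite sqr_sqrtr.
have := sum_cauchy_schwarz u (fun i => u i * (Num.sg (c i) * a i)).
have -> : \sum_i u i * (u i * (Num.sg (c i) * a i)) = \sum_i c i * a i.
  by apply: eq_bigr => i _; rewrite mulrA -expr2 uE mulrA (mulrC `|c i|) -numEsg.
move=> /le_trans; apply; under eq_bigr do rewrite uE.
rewrite ler_wpM2l ?sumr_ge0 //; apply: ler_sum => i _.
rewrite exprMn uE ler_wpM2l // exprMn sqr_sg.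
by rewrite ler_piMl ?sqr_ge0 // lern1 leq_b1.
Qed.

Lemma energy_shift f m : energy (fun x => f (x - m)) = energy f.
Proof.
rewrite /energy (reindex_inj (h := fun x => x + m)) /=; last exact: addIr.
by apply: eq_bigr => x _; rewrite addrK.
Qed.

Lemma energyD f h : energy (fun x => f x + h x) <= 2 * energy f + 2 * energy h.
Proof.
rewrite /energy !mulr_sumr -big_split; apply: ler_sum => x _ /=.
have := sqr_ge0 (f x - h x); lra.
Qed.

(** Convolution with the signed measure of mass [c i] at [s i]: all such operators commute, and the
    total variation bounds their norm. *)
Definition conv n (c : nat -> R) (s : nat -> G) f x : R :=
  \sum_(i < n) c i * f (x - s i).

Lemma convB n c s f h x :
  conv n c s (fun y => f y - h y) x = conv n c s f x - conv n c s h x.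
Proof. by rewrite /conv -sumrB; apply: eq_bigr => i _; rewrite mulrBr. Qed.

Lemma convD n c s f h x :
  conv n c s (fun y => f y + h y) x = conv n c s f x + conv n c s h x.
Proof. by rewrite /conv -big_split; apply: eq_bigr => i _; rewrite mulrDr. Qed.

Lemma eq_conv n c s f h x : f =1 h -> conv n c s f x = conv n c s h x.
Proof. by move=> e; apply: eq_bigr => i _; rewrite e. Qed.

Lemma convC n c s n' c' s' f x :
  conv n c s (conv n' c' s' f) x = conv n' c' s' (conv n c s f) x.
Proof.
rewrite /conv; under eq_bigr do rewrite mulr_sumr.
rewrite exchange_big /=; apply: eq_bigr => i _; rewrite mulr_sumr.
by apply: eq_bigr => j _; rewrite mulrCA addrAC.
Qed.

Lemma energy_conv n c s f :
  energy (conv n c s f) <= (\sum_(i < n) `|c i|) ^+ 2 * energy f.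
Proof.
apply: (@le_trans _ _ (\sum_x (\sum_(i < n) `|c i|) *
    \sum_(i < n) `|c i| * f (x - s i) ^+ 2)).
  by apply: ler_sum => x _; exact: sqr_weighted_sum.
rewrite -mulr_sumr exchange_big expr2 -mulrA ler_wpM2l ?sumr_ge0 //=.
rewrite mulr_suml; apply: ler_sum => i _.
by rewrite -mulr_sumr -/(energy (fun x => f (x - s i))) energy_shift.
Qed.

Definition dot f h : R := \sum_x f x * h x.

Lemma dot_conv n c s f h :
  dot (conv n c s f) h = dot f (conv n c (fun i => - s i) h).
Proof.
rewrite /dot /conv; under eq_bigr do rewrite mulr_suml.
under [RHS]eq_bigr do rewrite mulr_sumr.
rewrite exchange_big [RHS]exchange_big /=; apply: eq_bigr => i _.
rewrite (reindex_inj (h := fun x => x + s i)) /=; last exact: addIr.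
by apply: eq_bigr => x _; rewrite addrK opprK; ring.
Qed.

Lemma dot_energy f h : dot f h ^+ 2 <= energy f * energy h.
Proof. exact: sum_cauchy_schwarz. Qed.

(** * The maximal function along a cyclic subgroup *)

(** Dividing by [r] although there are [2 * r] terms gives total mass 2. *)
Definition symavg g (r : nat) f x : R :=
  r%:R^-1 * \sum_(i < 2 * r) f (x + g *+ r - g *+ i).

Lemma symavg_ge0 g r f x : (forall y, 0 <= f y) -> 0 <= symavg g r f x.
Proof. by move=> f0; rewrite mulr_ge0 ?invr_ge0 ?ler0n // sumr_ge0. Qed.

(** The adjoint of the linearised maximal operator [T], whose value at [x] is
    [symavg g (r x) f x]. *)
Definition adjoint_symavg g (r : G -> nat) h y : R :=
  \sum_x \sum_(i < 2 * r x)
    (x + g *+ r x - g *+ i == y)%:R * ((r x)%:R^-1 * h x).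

Lemma dot_adjoint_symavg g (r : G -> nat) f h :
  \sum_x h x * symavg g (r x) f x = dot f (adjoint_symavg g r h).
Proof.
rewrite /dot /adjoint_symavg; under [RHS]eq_bigr do rewrite mulr_sumr.
rewrite exchange_big; apply: eq_bigr => x _ /=.
under [RHS]eq_bigr do rewrite mulr_sumr.
rewrite exchange_big /= /symavg !mulr_sumr; apply: eq_bigr => i _.
rewrite (bigD1 (x + g *+ r x - g *+ i)) //= eqxx mulr1n big1 ?addr0; first by ring.
by move=> y; rewrite eq_sym => /negPf ->; rewrite mul0r mulr0.
Qed.

Lemma sum_widen_ge0 (F : nat -> R) a n n' : (forall i, 0 <= F i) ->
  (a + n <= n')%N -> \sum_(i < n) F (a + i)%N <= \sum_(i < n') F i.
Proof.
move=> F0 le_n; rewrite -(subnKC le_n) big_split_ord /= big_split_ord /=.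
by rewrite -addrA addrCA lerDl addr_ge0 ?sumr_ge0.
Qed.

Lemma eq_subM g x y a b c d : (x + g *+ a - g *+ b == y + g *+ c - g *+ d) =
  (x + g *+ (a + d) == y + g *+ (c + b)).
Proof.
rewrite subr_eq addrAC [RHS]eq_sym -[in LHS](inj_eq (addIr (g *+ d))).
by rewrite subrK eq_sym !mulrnDr !addrA eq_sym.
Qed.

(* [T T^* <= 4 (S + S^* )] pointwise, where [T] averages with radius [r x] and [S]
   with radius [2 * r x]; this is the half of that bound with [r x' <= r x]. *)
Lemma adjoint_symavg_kernel g (r : G -> nat) h x : (forall z, 0 < r z)%N ->
  (forall z, 0 <= h z) ->
  \sum_(x' | (r x' <= r x)%N) \sum_(i' < 2 * r x') \sum_(i < 2 * r x)
     (x' + g *+ r x' - g *+ i' == x + g *+ r x - g *+ i)%:R *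
       ((r x')%:R^-1 * h x')
  <= 4 * (r x)%:R * symavg g (2 * r x) h x.
Proof.
move=> r0 h0.
pose e (z : G) (k : nat) : R := (z == x + g *+ (2 * r x) - g *+ k)%:R.
apply: (@le_trans _ _ (\sum_x' \sum_(k < 2 * (2 * r x)) e x' k * (2 * h x'))).
  rewrite big_mkcond /=; apply: ler_sum => x' _; case: ifPn => [le_r|_]; last first.
    by apply: sumr_ge0 => k _; rewrite !mulr_ge0.
  have rx0 : (r x')%:R != 0 :> R by rewrite pnatr_eq0 -lt0n.
  (* The factor 2 is spread over the [2 * r x'] values of [i'], each carrying the weight
     [1 / r x']. *)
  have -> : \sum_(k < 2 * (2 * r x)) e x' k * (2 * h x') =
     \sum_(i' < 2 * r x') (\sum_(k < 2 * (2 * r x)) e x' k * ((r x')%:R^-1 * h x')).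
    rewrite [RHS]sumr_const card_ord -[RHS]mulr_natl mulr_sumr natrM.
    by apply: eq_bigr => k _; field.
  apply: ler_sum => i' _.
  rewrite -!mulr_suml ler_wpM2r ?mulr_ge0 ?invr_ge0 ?ler0n //.
  have := ltn_ord i'; move: (nat_of_ord i') => k lt_k.
  (* For fixed [i' = k], the index [i] becomes [r x + r x' - k + i], which stays below [4 * r x]
     because [r x' <= r x]. *)
  apply: le_trans (@sum_widen_ge0 (e x') (r x + r x' - k) (2 * r x) _ _ _).
  - apply: ler_sum => i _; rewrite /e le_eqVlt; apply/orP; left; apply/eqP.
    congr ((nat_of_bool _)%:R).
    rewrite eq_subM [RHS]eq_sym [RHS]subr_eq [RHS]eq_sym.
    rewrite -[LHS](inj_eq (addIr (g *+ r x))) -[RHS](inj_eq (addIr (g *+ k))).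
    rewrite -!addrA -!mulrnDr; congr (_ + g *+ _ == _ + g *+ _); try lia.
  - by move=> k'; rewrite ler0n.
  - lia.
rewrite exchange_big /symavg mulrA mulr_sumr /=; apply: ler_sum => k _.
have rx0 : (r x)%:R != 0 :> R by rewrite pnatr_eq0 -lt0n.
rewrite (bigD1 (x + g *+ (2 * r x) - g *+ k)) //= big1 => [|x' /negPf].
  by rewrite /e eqxx mulr1n le_eqVlt natrM; apply/orP; left; apply/eqP; field.
by rewrite /e => ->; rewrite mul0r.
Qed.

(** The energy expands into a double sum with a symmetric kernel. Pairs are split by which radius is
    larger; symmetry turns one half into the other, and the kernel bound applies to each. *)
Lemma energy_adjoint_symavg g (r : G -> nat) h : (forall z, 0 < r z)%N ->
  (forall z, 0 <= h z) ->
  energy (adjoint_symavg g r h) <=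
    8 * \sum_x h x * symavg g (2 * r x) h x.
Proof.
move=> r0 h0.
pose K x x' : R := \sum_(i' < 2 * r x') \sum_(i < 2 * r x)
   (x' + g *+ r x' - g *+ i' == x + g *+ r x - g *+ i)%:R *
     ((r x')%:R^-1 * h x').
have step x : (r x)%:R^-1 * h x * \sum_(x' | (r x' <= r x)%N) K x x' <=
    4 * (h x * symavg g (2 * r x) h x).
  apply: le_trans (ler_wpM2l _ (adjoint_symavg_kernel g x r0 h0)) _.
    by rewrite mulr_ge0 ?invr_ge0.
  have rx0 : (r x)%:R != 0 :> R by rewrite pnatr_eq0 -lt0n.
  by rewrite le_eqVlt; apply/orP; left; apply/eqP; field.
have symK x x' : (r x)%:R^-1 * h x * K x x' = (r x')%:R^-1 * h x' * K x' x.
  rewrite /K exchange_big !mulr_sumr; apply: eq_bigr => i _.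
  rewrite !mulr_sumr; apply: eq_bigr => j _ /=; rewrite (eq_sym (x + _ - _)); ring.
have -> : energy (adjoint_symavg g r h) =
    \sum_x \sum_x' (r x)%:R^-1 * h x * K x x'.
  transitivity (dot (adjoint_symavg g r h) (adjoint_symavg g r h)).
    by apply: eq_bigr => x _; rewrite expr2.
  rewrite -dot_adjoint_symavg; apply: eq_bigr => x _.
  rewrite /symavg /adjoint_symavg exchange_big /= !mulr_sumr.
  apply: eq_bigr => x' _; rewrite /K exchange_big /= !mulr_sumr.
  apply: eq_bigr => i _; rewrite !mulr_sumr; apply: eq_bigr => j _ /=.
  by rewrite (eq_sym (x' + _ - _)); ring.
rewrite (eq_bigr (fun x =>
    (r x)%:R^-1 * h x * (\sum_(x' | (r x' <= r x)%N) K x x') +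
    \sum_(x' | ~~ (r x' <= r x)%N) (r x)%:R^-1 * h x * K x x')); last first.
  by move=> x _; rewrite (bigID (fun x' => r x' <= r x)%N) /= mulr_sumr.
set X := \sum_x h x * _; rewrite big_split /= (_ : 8 * X = 4 * X + 4 * X); last by ring.
rewrite /X !mulr_sumr lerD //; first by apply: ler_sum => x _; exact: step.
rewrite (exchange_big_dep predT) //=; apply: ler_sum => x _.
apply: le_trans (step x); rewrite mulr_sumr.
rewrite [leLHS]big_mkcond [leRHS]big_mkcond; apply: ler_sum => x' _.
rewrite symK; case: (leqP (r x) (r x')) => [le_r|lt_r] /=.
  case: ifP => // _; rewrite mulr_ge0 ?mulr_ge0 ?invr_ge0 //.
  by apply: sumr_ge0 => i _; apply: sumr_ge0 => j _; rewrite !mulr_ge0 ?invr_ge0.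
by rewrite (ltnW lt_r).
Qed.

(** The arbitrary radius function [r] linearises the supremum. *)
Definition maximal_bound g (b : R) := 0 <= b /\ forall (r : G -> nat) f,
  (forall z, 0 < r z)%N -> \sum_x symavg g (r x) f x ^+ 2 <= b * energy f.

(** A crude bound growing with the size of [G], which makes the set of bounds nonempty so that its
    infimum can be taken. *)
Lemma maximal_bound_trivial g : exists b, maximal_bound g b.
Proof.
exists (\sum_(x : G) 4); split => [|r f r0]; first exact: sumr_ge0.
rewrite mulr_suml; apply: ler_sum => x _.
have rx0 : (r x)%:R != 0 :> R by rewrite pnatr_eq0 -lt0n.
have := sqr_weighted_sum (fun i : 'I_(2 * r x) => (r x)%:R^-1)
  (fun i => f (x + g *+ r x - g *+ i)).
rewrite /symavg -mulr_sumr => /le_trans; apply.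
have -> : \sum_(i < 2 * r x) `|(r x)%:R^-1| = 2 :> R.
  by rewrite sumr_const card_ord ger0_norm // -[LHS]mulr_natl natrM; field.
apply: (@le_trans _ _ (2 * (\sum_(i < 2 * r x) (r x)%:R^-1 * energy f))).
  rewrite ler_wpM2l //; apply: ler_sum => i _.
  rewrite ger0_norm ?invr_ge0 // ler_wpM2l ?invr_ge0 //.
  rewrite /energy (bigD1 (x + g *+ r x - g *+ i)) //= lerDl.
  by apply: sumr_ge0 => y _; exact: sqr_ge0.
rewrite sumr_const card_ord -[X in 2 * X]mulr_natl natrM le_eqVlt.
by apply/orP; left; apply/eqP; field.
Qed.

Lemma symavg_norm g r f x : `|symavg g r f x| <= symavg g r (fun y => `|f y|) x.
Proof.
rewrite /symavg normrM ger0_norm ?invr_ge0 // ler_wpM2l ?invr_ge0 //.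
exact: ler_norm_sum.
Qed.

(* Since [|T|^2 = |T T^*| <= 8 |S|] and [S] is an average of the same kind, the
   best bound [b] satisfies [b <= b / 2 + 32]. *)
Lemma maximal_bound_improve g b :
  maximal_bound g b -> maximal_bound g (b / 2 + 32).
Proof.
case=> b0 bP; split => [|r f0 r0]; first by lra.
pose f x := `|f0 x|.
have Ef : energy f = energy f0.
  by apply: eq_bigr => x _; rewrite real_normK ?num_real.
pose h x := symavg g (r x) f x.
have h0 x : 0 <= h x by apply: symavg_ge0 => y; exact: normr_ge0.
apply: (@le_trans _ _ (energy h)).
  apply: ler_sum => x _; rewrite -(real_normK (num_real (symavg _ _ _ _))).
  by rewrite ler_sqr ?nnegrE ?normr_ge0 //; exact: symavg_norm.
rewrite -Ef; set H := energy h; set F := energy f.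
have H0 : 0 <= H := energy_ge0 h.
have F0 : 0 <= F := energy_ge0 f.
pose X := \sum_x h x * symavg g (2 * r x) h x.
have X2 : X ^+ 2 <= H * (b * H).
  apply: le_trans (sum_cauchy_schwarz _ _) _; rewrite ler_wpM2l //.
  by apply: (bP (fun x => (2 * r x)%N)) => z; rewrite muln_gt0 r0.
(* Duality: [H] is the product of [f] with the adjoint applied to [h], so Cauchy-Schwarz bounds it
   by the energy of the latter. *)
have HX : H ^+ 2 <= F * (8 * X).
  have -> : H = dot f (adjoint_symavg g r h).
    by rewrite -dot_adjoint_symavg; apply: eq_bigr => x _; rewrite expr2.
  apply: le_trans (dot_energy _ _) _; rewrite ler_wpM2l //.
  exact: energy_adjoint_symavg.
have X0 : 0 <= X.
  apply: sumr_ge0 => x _; apply: mulr_ge0 (h0 x) _; exact: symavg_ge0.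
have : (H ^+ 2) ^+ 2 <= (F * (8 * X)) ^+ 2.
  by rewrite ler_sqr ?nnegrE ?sqr_ge0 // !mulr_ge0.
have FX : (F * (8 * X)) ^+ 2 <= 64 * F ^+ 2 * (b * H ^+ 2).
  rewrite (_ : _ ^+ 2 = 64 * F ^+ 2 * X ^+ 2); last by ring.
  by rewrite ler_wpM2l ?mulr_ge0 ?sqr_ge0 //; nra.
move=> /le_trans-/(_ _ FX) HF.
case: (leP H ((b / 2 + 32) * F)) => // lt_H.
have Hp : 0 < H by apply: le_lt_trans lt_H; rewrite mulr_ge0 //; lra.
have : H ^+ 2 <= 64 * F ^+ 2 * b.
  by rewrite -(ler_pM2r (exprn_gt0 2 Hp)) -expr2 -[leRHS]mulrA.
have : ((b / 2 + 32) * F) ^+ 2 < H ^+ 2.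
  by rewrite ltr_sqr ?nnegrE // mulr_ge0 //; lra.
(* Arithmetic-geometric mean: the two sides differ by the square of [(b / 2 - 32) * F]. *)
have : 64 * F ^+ 2 * b <= ((b / 2 + 32) * F) ^+ 2.
  rewrite -subr_ge0 (_ : _ - _ = ((b / 2 - 32) * F) ^+ 2) ?sqr_ge0 //.
  by field.
lra.
Qed.

(** The infimum [b] of all bounds satisfies [b <= b / 2 + 32], hence [b <= 64], whatever the
    group. *)
Lemma maximal_inequality g (r : G -> nat) f : (forall z, 0 < r z)%N ->
  \sum_x symavg g (r x) f x ^+ 2 <= 64 * energy f.
Proof.
move=> r0; pose B := [set b | maximal_bound g b].
have B0 : B !=set0 by have [b bP] := maximal_bound_trivial g; exists b.
have Blb : has_lbound B by exists 0 => b [].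
have lb_inf b : B b -> inf B <= b by move=> Bb; exact: ge_inf.
have inf64 : inf B <= 64.
  have : 2 * (inf B - 32) <= inf B.
    apply: lb_le_inf => // b Bb; have := lb_inf _ (maximal_bound_improve Bb); lra.
  lra.
apply: (@le_trans _ _ (inf B * energy f)); last first.
  by rewrite ler_wpM2r // energy_ge0.
have := energy_ge0 f; rewrite le_eqVlt => /orP[/eqP E0|E0].
  by have [b [b0 /(_ r f r0)]] := B0; rewrite -E0 !mulr0.
rewrite -ler_pdivrMr //; apply: lb_le_inf => // b [_ /(_ r f r0)].
by rewrite ler_pdivrMr.
Qed.

(** * Averages and almost orthogonality *)

Lemma sum_block (F : nat -> R) u s :
  \sum_(i < u * s) F i = \sum_(q < s) \sum_(i < u) F (u * q + i)%N.
Proof.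
elim: s => [|s IH]; first by rewrite muln0 !big_ord0.
by rewrite big_ord_recr -IH mulnS addnC big_split_ord.
Qed.

Lemma sum_split_swap (F : nat -> R) a r : \sum_(i < r) (F i - F (a + i)%N) =
  \sum_(i < a) F i - \sum_(i < a) F (r + i)%N.
Proof.
have : \sum_(i < r + a) F i = \sum_(i < a + r) F i by rewrite addnC.
rewrite !big_split_ord /= sumrB => E.
by apply/eqP; rewrite subr_eq addrAC eq_sym subr_eq E.
Qed.

Definition avg m r f : G -> R := conv r (fun=> r%:R^-1) (fun i => m *+ i) f.

Lemma energy_avg m r f : (0 < r)%N -> energy (avg m r f) <= energy f.
Proof.
move=> r0; apply: le_trans (energy_conv _ _ _ _) _.
rewrite sumr_const card_ord ger0_norm ?invr_ge0 // -[_ *+ r]mulr_natl.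
by rewrite divff ?pnatr_eq0 -?lt0n // expr1n mul1r.
Qed.

Lemma energy_sub_avg m r f : (0 < r)%N ->
  energy (fun x => f x - avg m r f x) <= 4 * energy f.
Proof.
move=> r0; apply: le_trans (energyD f (fun x => - avg m r f x)) _.
have := energy_avg m f r0; rewrite {1}/energy.
under eq_bigr do rewrite -sqrrN; rewrite -/(energy _); lra.
Qed.

(** Each [f x - f (x - m *+ i)] telescopes into steps of [m]; counting how often the step at [s]
    occurs gives the triangular weight. A first difference is thus factored out of [1 - avg]. *)
Lemma sub_avg m r f x : (0 < r)%N -> f x - avg m r f x =
  conv r (fun s => (r%:R - s.+1%:R) / r%:R) (fun s => m *+ s)
    (fun y => f y - f (y - m)) x.
Proof.
move=> r0; have r0R : r%:R != 0 :> R by rewrite pnatr_eq0 -lt0n.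
apply: (mulfI r0R); rewrite /avg /conv mulrBr !mulr_sumr.
under eq_bigr do rewrite mulVKf //.
under [RHS]eq_bigr do rewrite mulrA mulrCA divff // mulr1.
elim: r {r0 r0R} => [|r IH]; first by rewrite !big_ord0 mul0r subr0.
rewrite big_ord_recr [RHS]big_ord_recr /= subrr mul0r addr0.
rewrite -natr1 mulrDl mul1r opprD addrACA IH.
have -> : f x - f (x - m *+ r) =
    \sum_(s < r) (f (x - m *+ s) - f (x - m *+ s - m)).
  under eq_bigr do rewrite -addrA -opprD -mulrSr.
  elim: r {IH} => [|r IH]; first by rewrite big_ord0 mulr0n subr0 subrr.
  by rewrite big_ord_recr /= -IH; ring.
by rewrite -big_split; apply: eq_bigr => s _ /=; ring.
Qed.

Lemma energy_triangular_conv m r f : (0 < r)%N ->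
  energy (conv r (fun s => (r%:R - s.+1%:R) / r%:R) (fun s => m *+ s) f) <=
  r%:R ^+ 2 * energy f.
Proof.
move=> r0; apply: le_trans (energy_conv _ _ _ _) _.
rewrite ler_wpM2r ?energy_ge0 // ler_sqr ?nnegrE ?sumr_ge0 //.
rewrite -[leRHS](@mulr_natl R 1) mulr1 -[r in leRHS]card_ord -sumr_const.
apply: ler_sum => s _; rewrite ger0_norm.
  by rewrite ler_pdivrMr ?ltr0n // mul1r gerBl.
by rewrite divr_ge0 // subr_ge0 ler_nat.
Qed.

(** Averaging a difference over [a] steps telescopes: two boundary blocks of [a] terms of weight
    [1 / r] survive. *)
Lemma energy_avg_diff m r a f : (0 < r)%N ->
  energy (avg m r (fun y => f y - f (y - m *+ a))) <=
    4 * (a%:R / r%:R) ^+ 2 * energy f.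
Proof.
move=> r0.
pose p (s : nat -> G) := conv a (fun=> r%:R^-1) s f.
have Ep s : energy (p s) <= (a%:R / r%:R) ^+ 2 * energy f.
  apply: le_trans (energy_conv _ _ _ _) _.
  by rewrite sumr_const card_ord ger0_norm ?invr_ge0 // -[_ *+ a]mulr_natl.
pose q x := - p (fun i => m *+ (r + i)) x.
have -> : energy (avg m r (fun y => f y - f (y - m *+ a))) =
    energy (fun x => p (fun i => m *+ i) x + q x).
  apply: eq_bigr => x _; congr (_ ^+ 2); rewrite /q /p /avg /conv.
  rewrite -!mulr_sumr -mulrBr; congr (_ * _).
  rewrite -(sum_split_swap (fun i => f (x - m *+ i))).
  by apply: eq_bigr => i _; rewrite addnC mulrnDr opprD addrA.
apply: le_trans (energyD _ _) _.
have -> : energy q = energy (p (fun i => m *+ (r + i))).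
  by apply: eq_bigr => x _; rewrite sqrrN.
have := Ep (fun i => m *+ i); have := Ep (fun i => m *+ (r + i)); lra.
Qed.

(** * Almost orthogonality along directions linked by Bezout relations *)

Section Orthogonality.
Variables (N S r b : nat) (m : 'I_N -> G) (g : G).
Hypotheses (S0 : (0 < S)%N) (r0 : (0 < r)%N) (le_r : (4 * N * S * b <= r)%N).
Hypothesis bezout : forall i j, i != j ->
  exists a a', [/\ (a <= b)%N, (a' <= b)%N & m i *+ a = g + m j *+ a'].

Let w f x := f x - avg g S f x.

(** [w f] is a triangular sum of differences along [g], and Bezout turns a difference along [g] into
    differences along [m i] and [m j] of at most [b] steps. Each is damped to order [b / r] by the
    average in its own direction; [le_r] beats the total loss [4 * S * b / r] by a factor [N]. *)
Lemma energy_avg_avg_sub i j f : i != j ->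
  N%:R ^+ 2 * energy (avg (m i) r (avg (m j) r (w f))) <= energy f.
Proof.
move=> /bezout[a [a' [le_a le_a' eq_g]]].
pose z y := f y - f (y - g).
pose P h := avg (m i) r (avg (m j) r h).
have r0R : r%:R != 0 :> R by rewrite pnatr_eq0 -lt0n.
have E1 : energy (P (w f)) <= S%:R ^+ 2 * energy (P z).
  apply: le_trans (energy_triangular_conv g (P z) S0).
  rewrite le_eqVlt; apply/orP; left; apply/eqP; apply: eq_bigr => x _.
  congr (_ ^+ 2); rewrite /P /avg.
  transitivity (avg (m i) r (avg (m j) r
    (conv S (fun s => (S%:R - s.+1%:R) / S%:R) (fun s => g *+ s) z)) x).
    by rewrite /avg; apply: eq_conv => y; apply: eq_conv => y'; exact: sub_avg.
  rewrite /avg [RHS]convC; apply: eq_conv => y; exact: convC.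
(* Bezout gives [z = p - q], because [f (y - m i *+ a)] and [F (y - m j *+ a')] are the same
   value. *)
pose F y := f (y - g).
pose p y := f y - f (y - m i *+ a).
pose q y := F y - F (y - m j *+ a').
have E2 : energy (P z) <= 2 * energy (P p) + 2 * energy (P q).
  have -> : energy (P q) = energy (fun x => - P q x).
    by apply: eq_bigr => x _; rewrite sqrrN.
  apply: le_trans (energyD _ _); rewrite le_eqVlt; apply/orP; left; apply/eqP.
  apply: eq_bigr => x _; congr (_ ^+ 2); rewrite /P /avg -convB.
  apply: eq_conv => y; rewrite -convB; apply: eq_conv => y'.
  rewrite /z /p /q /F eq_g opprD !addrA (addrAC _ (- g)) ; ring.
have le_b c : (c <= b)%N -> 4 * (c%:R / r%:R) ^+ 2 <= 4 * (b%:R / r%:R) ^+ 2 :> R.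
  move=> le_c; rewrite ler_wpM2l // ler_sqr ?nnegrE ?divr_ge0 //.
  by rewrite ler_wpM2r ?invr_ge0 // ler_nat.
have E3 : energy (P p) <= 4 * (b%:R / r%:R) ^+ 2 * energy f.
  have -> : energy (P p) = energy (avg (m j) r (avg (m i) r p)).
    by apply: eq_bigr => x _; rewrite /P /avg convC.
  apply: le_trans (energy_avg _ _ r0) _.
  apply: le_trans (energy_avg_diff _ _ _ r0) _.
  by rewrite ler_wpM2r ?energy_ge0 ?le_b.
have E4 : energy (P q) <= 4 * (b%:R / r%:R) ^+ 2 * energy f.
  apply: le_trans (energy_avg _ _ r0) _.
  apply: le_trans (energy_avg_diff _ _ _ r0) _.
  by rewrite energy_shift ler_wpM2r ?energy_ge0 ?le_b.
have E5 : energy (P (w f)) <=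
    S%:R ^+ 2 * (16 * (b%:R / r%:R) ^+ 2 * energy f).
  by apply: le_trans E1 _; rewrite ler_wpM2l ?sqr_ge0 //; lra.
apply: le_trans (ler_wpM2l (sqr_ge0 _) E5) _.
rewrite [leLHS](_ : _ = (4 * N%:R * S%:R * b%:R / r%:R) ^+ 2 * energy f); last by field.
rewrite ler_piMl ?energy_ge0 // expr_le1 ?divr_ge0 ?mulr_ge0 //.
by rewrite ler_pdivrMr ?ltr0n // mul1r -!natrM ler_nat.
Qed.

(** Write [X] for the sum and [F] for [energy f]. By duality [X] is the product of [w f] with [y],
    and the energy of [y] is the sum of the energies of all [Q i (Q j (w f))]: at most [X] from the
    diagonal and [F] from the rest. Cauchy-Schwarz gives [X^2 <= 4 F (X + F)], which forces
    [X <= 5 F]. *)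
Lemma sum_energy_avg_sub f :
  \sum_i energy (avg (m i) r (w f)) <= 5 * energy f.
Proof.
pose Q i := avg (m i) r.
pose Q' i := conv r (fun=> r%:R^-1 : R) (fun k => - (m i *+ k)).
pose y x := \sum_i Q' i (Q i (w f)) x.
set X := \sum_i _.
have XE : X = dot (w f) y.
  rewrite /dot /y; under [RHS]eq_bigr do rewrite mulr_sumr.
  rewrite exchange_big; apply: eq_bigr => i _ /=.
  rewrite -/(dot (w f) (Q' i (Q i (w f)))) -dot_conv.
  by apply: eq_bigr => x _; rewrite expr2.
have dotQ i j : dot (Q' i (Q i (w f))) (Q' j (Q j (w f))) =
    energy (Q i (Q j (w f))).
  rewrite dot_conv; transitivity (dot (Q i (w f)) (Q' j (Q i (Q j (w f))))).
    apply: eq_bigr => x _; congr (_ * _); rewrite /Q' [LHS]convC.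
    by apply: eq_conv => z; apply: eq_bigr => k _; rewrite opprK.
  rewrite -dot_conv; apply: eq_bigr => x _.
  by rewrite expr2; congr (_ * _); exact: convC.
have yE : energy y = \sum_i \sum_j dot (Q' i (Q i (w f))) (Q' j (Q j (w f))).
  rewrite /energy /y; under eq_bigr do rewrite expr2 big_distrlr /=.
  rewrite exchange_big; apply: eq_bigr => i _; exact: exchange_big.
have y_le : energy y <= X + energy f.
  rewrite yE; apply: (@le_trans _ _ (\sum_i (energy (Q i (w f)) +
      \sum_(j : 'I_N) (N%:R ^+ 2)^-1 * energy f))).
    apply: ler_sum => i _; rewrite (bigD1 i) //= lerD //.
      rewrite dotQ; exact: energy_avg.
    rewrite [leLHS]big_mkcond; apply: ler_sum => j _; case: ifPn => [ji|_].
      have N0 : 0 < N%:R :> R by rewrite ltr0n (leq_ltn_trans _ (ltn_ord i)).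
      rewrite dotQ mulrC ler_pdivlMr ?exprn_gt0 // mulrC.
      by apply: energy_avg_avg_sub; rewrite eq_sym.
    by rewrite mulr_ge0 ?invr_ge0 ?sqr_ge0 ?energy_ge0.
  rewrite big_split /= lerD2l !sumr_const card_ord -mulrnA -[leLHS]mulr_natl mulrA.
  rewrite natrM -expr2; have [->|N0] := eqVneq N 0; last first.
    by rewrite divff ?mul1r // sqrf_eq0 pnatr_eq0.
  by rewrite expr0n !mul0r energy_ge0.
have X2 : X ^+ 2 <= (4 * energy f) * (X + energy f).
  rewrite {1}XE; apply: le_trans (dot_energy _ _) _.
  apply: le_trans (ler_wpM2l (energy_ge0 _) y_le) _.
  rewrite ler_wpM2r ?energy_sub_avg // addr_ge0 ?energy_ge0 //.
  by apply: sumr_ge0 => i _; exact: energy_ge0.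
have := energy_ge0 f; move: X2; set F := energy f; move=> X2 F0.
case: (leP X (5 * F)) => // lt_X; nra.
Qed.

End Orthogonality.

Lemma symavg_le g r f h x : (forall y, f y <= h y) ->
  symavg g r f x <= symavg g r h x.
Proof.
move=> fh; rewrite /symavg ler_wpM2l ?invr_ge0 //; apply: ler_sum => i _.
exact: fh.
Qed.

(** Blocks of [u] consecutive multiples of [g] fill the gaps of the progression of step [g *+ u].
    With [S = u * s] this leaves [s] windows of length [2 * r * u], shifted by at most [S <= r * u],
    so all lie in the window of radius [2 * r * u]. *)
Lemma symavg_avg_le g u r S h x : (forall y, 0 <= h y) ->
  (0 < u)%N -> (0 < r)%N -> (0 < S)%N -> (u %| S)%N -> (S <= r * u)%N ->
  symavg (g *+ u) r (avg g S h) x <= 2 * symavg g (2 * r * u) h x.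
Proof.
move=> h0 u0 r0 S0 /dvdnP[s Es] le_S; rewrite mulnC in Es.
pose H e := h (x + g *+ (r * u) - g *+ e).
pose Z := \sum_(i < 2 * (2 * r * u)) h (x + g *+ (2 * r * u) - g *+ i).
have sR : s%:R != 0 :> R.
  by rewrite pnatr_eq0; apply: contraTneq S0 => s0; rewrite Es s0 muln0.
have uR : u%:R != 0 :> R by rewrite pnatr_eq0 -lt0n.
have rR : r%:R != 0 :> R by rewrite pnatr_eq0 -lt0n.
have -> : symavg (g *+ u) r (avg g S h) x =
    r%:R^-1 * S%:R^-1 * \sum_(q < s) \sum_(e < u * (2 * r)) H (u * q + e)%N.
  rewrite /symavg -mulrA; congr (_ * _); rewrite mulr_sumr.
  transitivity (\sum_(i < 2 * r) \sum_(q < s) \sum_(e < u)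
      S%:R^-1 * H (u * q + (u * i + e))%N).
    apply: eq_bigr => i _; rewrite /avg /conv Es.
    rewrite (sum_block (fun k => _ * h (_ - g *+ k))); apply: eq_bigr => q _.
    apply: eq_bigr => e _; congr (_ * h _).
    rewrite -!mulrnA (mulnC u r) -addrA -opprD -!mulrnDr; congr (_ - _ *+ _).
    lia.
  rewrite exchange_big; apply: eq_bigr => q _ /=.
  rewrite (sum_block (fun e => H (u * q + e)%N)) mulr_sumr.
  by apply: eq_bigr => i _; rewrite mulr_sumr.
have le_Z q : (q < s)%N -> \sum_(e < u * (2 * r)) H (u * q + e)%N <= Z.
  move=> lt_q; pose H' e := h (x + g *+ (2 * r * u) - g *+ e).
  have -> : \sum_(e < u * (2 * r)) H (u * q + e)%N =
      \sum_(e < u * (2 * r)) H' ((r * u + u * q) + e)%N.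
    apply: eq_bigr => e _; rewrite /H /H'; congr h; apply/eqP.
    rewrite eq_subM; apply/eqP; congr (_ + _ *+ _); lia.
  apply: sum_widen_ge0 => [e|]; first exact: h0.
  have : (u * q <= r * u)%N.
    by apply: leq_trans le_S; rewrite Es leq_mul2l (ltnW lt_q) orbT.
  lia.
apply: (@le_trans _ _ (r%:R^-1 * S%:R^-1 * \sum_(q < s) Z)).
  by rewrite ler_wpM2l ?mulr_ge0 ?invr_ge0 //; apply: ler_sum => q _; exact: le_Z.
rewrite sumr_const card_ord -[Z *+ s]mulr_natl /symavg -/Z Es !natrM.
by rewrite le_eqVlt; apply/orP; left; apply/eqP; field; rewrite uR rR sR.
Qed.

(** * Weighted averages at dyadic scales *)

Variables (rho : nat -> nat) (wt : nat -> nat -> R) (B V : R).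

(** Modelled on samples of a dilated bump function: height of order [1 / rho], slope of order
    [1 / rho^2], and zeros at both ends that remove the boundary terms from summation by parts. *)
Definition admissible_weights := [/\ (forall k, 2 ^ k <= rho k)%N,
  (forall k, wt k 0 = 0), (forall k, wt k (2 * rho k) = 0),
  (forall k i, `|wt k i| <= B / (rho k)%:R) &
  (forall k i, `|wt k i.+1 - wt k i| <= V / (rho k)%:R ^+ 2)].

Hypothesis wtP : admissible_weights.

Let rho_gt0 k : (0 < rho k)%N.
Proof. by case: wtP => le_rho _ _ _ _; apply: leq_trans (le_rho k); rewrite expn_gt0. Qed.

Lemma weights_bound_ge0 : 0 <= B.
Proof.
case: wtP => _ _ _ /(_ 0%N 0%N) leB _.
have : 0 <= B / (rho 0)%:R by apply: le_trans leB.
by rewrite pmulr_lge0 // invr_gt0 ltr0n.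
Qed.

Lemma wavgE m k f x :
  wavg rho wt m k f x = conv (2 * rho k) (wt k) (fun i => m *+ i - m *+ rho k) f x.
Proof. by apply: eq_bigr => i _; rewrite opprB addrA. Qed.

Lemma norm_wavg m k f x :
  `|wavg rho wt m k f x| <= B * symavg m (rho k) (fun y => `|f y|) x.
Proof.
case: wtP => _ _ _ leB _.
apply: le_trans (ler_norm_sum _ _ _) _; rewrite /symavg mulrA mulr_sumr.
by apply: ler_sum => i _; rewrite normrM ler_wpM2r.
Qed.

Lemma maximal_wavg1 g (k : G -> nat) f :
  \sum_x wavg rho wt g (k x) f x ^+ 2 <= 64 * B ^+ 2 * energy f.
Proof.
have -> : energy f = energy (fun y => `|f y|).
  by apply: eq_bigr => x _; rewrite real_normK ?num_real.
have := maximal_inequality g (fun y => `|f y|) (fun x => rho_gt0 (k x)).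
move=> /(ler_wpM2l (sqr_ge0 B)) le64.
rewrite [64 * _]mulrC -mulrA; apply: le_trans le64.
rewrite mulr_sumr; apply: ler_sum => x _.
rewrite -(real_normK (num_real (wavg _ _ _ _ _ _))) -exprMn.
have sa_ge0 : 0 <= symavg g (rho (k x)) (fun y => `|f y|) x.
  by apply: symavg_ge0 => y.
by rewrite ler_sqr ?nnegrE ?norm_wavg ?(mulr_ge0 weights_bound_ge0 sa_ge0).
Qed.

(** Summation by parts moves the difference onto the weights, whose total variation is at most
    [2 * V / rho k]. *)
Lemma energy_wavg_diff m k f : energy (wavg rho wt m k (fun y => f y - f (y - m))) <=
  (2 * V / (rho k)%:R) ^+ 2 * energy f.
Proof.
case: wtP => _ wt0 wt_end _ leV.
have -> : energy (wavg rho wt m k (fun y => f y - f (y - m))) =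
    energy (conv (2 * rho k) (fun i => wt k i.+1 - wt k i)
      (fun i => m *+ i.+1 - m *+ rho k) f).
  apply: eq_bigr => x _; congr (_ ^+ 2).
  pose H i := f (x + m *+ rho k - m *+ i).
  transitivity (\sum_(i < 2 * rho k) (wt k i * H i - wt k i * H i.+1)).
    apply: eq_bigr => i _; rewrite mulrBr /H; congr (_ - _ * f _).
    by rewrite mulrSr opprD addrA.
  transitivity (\sum_(i < 2 * rho k) (wt k i.+1 * H i.+1 - wt k i * H i.+1)).
    rewrite !sumrB; congr (_ - _); apply/eqP.
    rewrite -(inj_eq (addIr (wt k (2 * rho k)%N * H (2 * rho k)%N))).
    rewrite -(big_ord_recr (2 * rho k) (fun i => wt k i * H i)) big_ord_recl /=.
    by rewrite wt0 wt_end !mul0r add0r addr0.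
  apply: eq_bigr => i _; rewrite -mulrBl /H; congr (_ * f _).
  by rewrite opprB addrA.
apply: le_trans (energy_conv _ _ _ _) _.
rewrite ler_wpM2r ?energy_ge0 //.
have rR : (rho k)%:R != 0 :> R by rewrite pnatr_eq0 -lt0n.
have leS : \sum_(i < 2 * rho k) `|wt k i.+1 - wt k i| <= 2 * V / (rho k)%:R.
  apply: (@le_trans _ _ (\sum_(i < 2 * rho k) V / (rho k)%:R ^+ 2)).
    by apply: ler_sum.
  rewrite sumr_const card_ord -[_ *+ _]mulr_natl natrM le_eqVlt.
  by apply/orP; left; apply/eqP; field.
have S0 : 0 <= \sum_(i < 2 * rho k) `|wt k i.+1 - wt k i| by apply: sumr_ge0.
by rewrite ler_sqr ?nnegrE // (le_trans S0).
Qed.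

(** [1 - avg] is a first difference followed by a convolution of mass at most [r], so the result is
    negligible once [rho k] is much longer than [r]. *)
Lemma energy_wavg_sub_avg m k r f : (0 < r)%N ->
  energy (wavg rho wt m k (fun y => f y - avg m r f y)) <=
  r%:R ^+ 2 * ((2 * V / (rho k)%:R) ^+ 2 * energy f).
Proof.
move=> r0; apply: le_trans (_ : r%:R ^+ 2 *
    energy (wavg rho wt m k (fun y => f y - f (y - m))) <= _); last first.
  by rewrite ler_wpM2l ?sqr_ge0 //; exact: energy_wavg_diff.
apply: le_trans (energy_triangular_conv m _ r0).
rewrite le_eqVlt; apply/orP; left; apply/eqP; apply: eq_bigr => x _.
congr (_ ^+ 2); rewrite wavgE.
under [RHS]eq_conv do rewrite wavgE.
rewrite [RHS]convC; apply: eq_conv => y; exact: sub_avg.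
Qed.

End FiniteGroup.

(** * Maximal estimates along pairwise coprime multiples *)

Section FiniteMaximal.
Variables (R : realType) (rho : nat -> nat) (wt : nat -> nat -> R) (B V : R).
Hypothesis wtP : admissible_weights rho wt B V.

(** [k] and [j] choose a scale and a direction at each point, which linearises both suprema; [P]
    restricts the scales. One constant serves all finite groups, as transference requires. *)
Definition maximal_estimate N (u : 'I_N -> nat) (P : nat -> Prop) (C : R) :=
  forall (G : finZmodType) (g : G) (k : G -> nat) (j : G -> 'I_N) (f : G -> R),
    (forall x, P (k x)) ->
  \sum_x wavg rho wt (g *+ u (j x)) (k x) f x ^+ 2 <= C * energy f.

(** A single direction is controlled at every scale. This settles [N = 1], where [N^C1 = 1] cannot
    enforce long scales; the constant is that of the general case. *)
Lemma maximal_estimate1 (u : 'I_1 -> nat) (P : nat -> Prop) :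
  maximal_estimate u P (1728 * B ^+ 2 + 3).
Proof.
move=> G g k j f _; under eq_bigr do rewrite (ord1 (j _)).
apply: le_trans (maximal_wavg1 wtP _ _ _) _; rewrite ler_wpM2r ?energy_ge0 //.
have := sqr_ge0 B; lra.
Qed.

Lemma coprime_bezout (x y : nat) : (0 < x)%N -> coprime x y ->
  exists a a', [/\ (a <= y.+1)%N, (a' <= x)%N & (x * a = 1 + y * a')%N].
Proof.
move=> x0 /eqP co; have [a' lt_a'] := Bezoutl y x0.
rewrite co => /dvdnP[a Ea]; exists a, a'; split; [|exact: ltnW|lia].
rewrite -(leq_pmul2r x0) -Ea; nia.
Qed.

Lemma sum_half_pow_le2 n : \sum_(k < n) (2^-1 : R) ^+ k <= 2.
Proof.
suff -> : \sum_(k < n) (2^-1 : R) ^+ k = 2 - 2 * 2^-1 ^+ n.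
  by rewrite gerBl mulr_ge0 ?exprn_ge0 ?invr_ge0.
elim: n => [|n IH]; first by rewrite big_ord0 expr0; ring.
by rewrite big_ord_recr /= IH exprSr; field.
Qed.

(* Writing [E] for an average along the common divisor [g] and [Q j] for a
   longer one along [g *+ u j], one splits [f] as [E f], [Q j (f - E f)] and
   [(1 - Q j) (f - E f)].  The averages of the first are dominated by the maximal
   function along [g]; the second has a bounded square function because the
   [Q j] are almost orthogonal off the range of [E]; the third is negligible at
   scales much longer than those of [Q j]. *)
Lemma maximal_estimate_coprime N (u : 'I_N -> nat) : (forall i, 0 < u i)%N ->
  (forall i j, i != j -> coprime (u i) (u j)) ->
  exists W : nat,
    maximal_estimate u (fun k => W <= 2 ^ k)%N (1728 * B ^+ 2 + 3).
Proof.
(* [S] is divisible by every [u i], [b] bounds the Bezout coefficients, [r] is long enough for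
   almost orthogonality, and [W] exceeds both [S] and the loss [c] from the third term. *)
move=> u0 co; pose S := (\prod_i u i)%N; pose b := (\sum_i u i).+1.
pose r := (4 * N * S * b).+1.
pose c : R := 32 * N%:R * r%:R ^+ 2 * V ^+ 2.
pose W := (S + Num.bound c).+1.
have S0 : (0 < S)%N by rewrite prodn_gt0.
have c0 : 0 <= c by rewrite /c mulr_ge0 ?sqr_ge0 // !mulr_ge0.
have lt_cW : c < W%:R.
  apply: lt_le_trans (archi_boundP c0) _; rewrite ler_nat /W; lia.
have W0 : 0 < W%:R :> R by rewrite ltr0n.
have [le_rho _ _ _ _] := wtP.
have rho0 k : (0 < rho k)%N by apply: leq_trans (le_rho k); rewrite expn_gt0.
exists W => G g k j f leW.
pose m i := g *+ u i.
pose w x := f x - avg g S f x.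
have bezout i i' : i != i' -> exists a a',
    [/\ (a <= b)%N, (a' <= b)%N & m i *+ a = g + m i' *+ a'].
  have le_b l : (u l <= \sum_i u i)%N by rewrite (bigD1 l) //= leq_addr.
  move=> /co /(coprime_bezout (u0 i))[a [a' [le_a le_a' E]]]; exists a, a'.
  split; first by rewrite (leq_trans le_a) // ltnS.
    by rewrite (leq_trans le_a') // (leq_trans (le_b i)).
  by rewrite /m -!mulrnA E mulrnDr.
pose P1 x := wavg rho wt (m (j x)) (k x) (avg g S f) x.
pose P2 x := wavg rho wt (m (j x)) (k x) (avg (m (j x)) r w) x.
pose P3 x := wavg rho wt (m (j x)) (k x)
  (fun y => w y - avg (m (j x)) r w y) x.
have split3 x : wavg rho wt (g *+ u (j x)) (k x) f x = P1 x + P2 x + P3 x.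
  rewrite /P1 /P2 /P3 !wavgE -!convD; apply: eq_conv => y.
  by rewrite /w; ring.
have B0 : 0 <= B := weights_bound_ge0 wtP.
have F0 := energy_ge0 f.
have E1 : \sum_x P1 x ^+ 2 <= 256 * B ^+ 2 * energy f.
  pose F x := `|f x|.
  have FE : energy F = energy f.
    by apply: eq_bigr => x _; rewrite real_normK ?num_real.
  have := maximal_inequality g (r := fun x => (2 * rho (k x) * u (j x))%N) F.
  rewrite FE => /(_ _) H.
  have {}H : \sum_x symavg g (2 * rho (k x) * u (j x)) F x ^+ 2 <=
      64 * energy f.
    by apply: H => x; rewrite !muln_gt0 rho0 u0.
  have := ler_wpM2l (_ : 0 <= 4 * B ^+ 2) H.
  rewrite mulr_ge0 ?sqr_ge0 // => /(_ isT) {}H.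
  rewrite (_ : 256 * _ * _ = 4 * B ^+ 2 * (64 * energy f)); last by ring.
  apply: le_trans H; rewrite mulr_sumr; apply: ler_sum => x _.
  have T0 : 0 <= symavg g (2 * rho (k x) * u (j x)) F x.
    by apply: symavg_ge0 => y; exact: normr_ge0.
  rewrite (_ : 4 * _ * _ =
    (B * (2 * symavg g (2 * rho (k x) * u (j x)) F x)) ^+ 2); last by ring.
  rewrite -(real_normK (num_real (P1 x))) ler_sqr ?nnegrE //; last first.
    by apply: mulr_ge0 => //; exact: mulr_ge0.
  apply: le_trans (norm_wavg wtP _ _ _ _) _; rewrite ler_wpM2l //.
  apply: le_trans (_ : symavg (m (j x)) (rho (k x)) (avg g S F) x <= _).
    apply: symavg_le => y; apply: le_trans (ler_norm_sum _ _ _) _.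
    by apply: ler_sum => i _; rewrite normrM ger0_norm ?invr_ge0.
  apply: symavg_avg_le => //.
  - by move=> y; exact: normr_ge0.
  - by rewrite /S (bigD1 (j x)) //= dvdn_mulr.
  - apply: leq_trans (leq_pmulr _ (u0 _)); apply: leq_trans (le_rho _).
    apply: leq_trans (leW x); rewrite /W; lia.
have E2 : \sum_x P2 x ^+ 2 <= 320 * B ^+ 2 * energy f.
  have Q5 := @sum_energy_avg_sub R G N S r b m g S0 isT (leqnSn _) bezout f.
  have B640 : 0 <= 64 * B ^+ 2 by rewrite mulr_ge0 ?sqr_ge0.
  have := ler_wpM2l B640 Q5; rewrite mulr_sumr => {}Q5.
  rewrite (_ : 320 * _ * _ = 64 * B ^+ 2 * (5 * energy f)); last by ring.
  apply: le_trans Q5.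
  (* The choice of direction is replaced by a sum over all directions, and the maximal inequality
     along each [m i] handles the choice of scale. *)
  apply: (@le_trans _ _ (\sum_i \sum_x wavg rho wt (m i) (k x) (avg (m i) r w) x ^+ 2)).
    rewrite exchange_big /=; apply: ler_sum => x _.
    rewrite (bigD1 (j x)) //= lerDl.
    by apply: sumr_ge0 => i _; apply: sqr_ge0.
  by apply: ler_sum => i _; apply: (maximal_wavg1 wtP).
have E3 : \sum_x P3 x ^+ 2 <= energy f.
  (* Here both choices are replaced by sums. Since [(rho l)^2 >= W * 2^l], the scales form a
     geometric series and the factor [1 / W] absorbs [c]. *)
  pose n := (\max_x k x).+1.
  pose D i l x := wavg rho wt (m i) l (fun y => w y - avg (m i) r w y) x.
  apply: (@le_trans _ _ (\sum_x \sum_i \sum_(l < n | (W <= 2 ^ l)%N) D i l x ^+ 2)).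
    apply: ler_sum => x _.
    have ltn : (k x < n)%N by rewrite ltnS; exact: leq_bigmax.
    rewrite (bigD1 (j x)) //= (bigD1 (Ordinal ltn)) //= -addrA lerDl addr_ge0 //.
      by apply: sumr_ge0 => i _; apply: sqr_ge0.
    by apply: sumr_ge0 => i _; apply: sumr_ge0 => l _; exact: sqr_ge0.
  rewrite exchange_big /=.
  apply: (@le_trans _ _ (\sum_(i < N) \sum_(l < n)
      16 * r%:R ^+ 2 * V ^+ 2 / W%:R * 2^-1 ^+ l * energy f)).
    apply: ler_sum => i _; rewrite exchange_big [leLHS]big_mkcond /=.
    apply: ler_sum => l _; case: ifPn => [leWl|_]; last first.
      rewrite mulr_ge0 ?energy_ge0 // mulr_ge0 ?exprn_ge0 ?invr_ge0 //.
      by rewrite mulr_ge0 ?invr_ge0 ?ler0n // mulr_ge0 ?sqr_ge0 // mulr_ge0 ?sqr_ge0.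
    apply: le_trans (energy_wavg_sub_avg wtP _ _ _ (ltn0Sn _)) _.
    have rl : (2 ^ l)%:R <= (rho l)%:R :> R by rewrite ler_nat.
    have Wl : W%:R <= (2 ^ l)%:R :> R by rewrite ler_nat.
    rewrite natrX in rl Wl; rewrite exprVn.
    have p0 : 0 < (2 : R) ^+ l by rewrite exprn_gt0.
    have rhoR0 : 0 < (rho l)%:R :> R by rewrite ltr0n.
    have inv_le : ((rho l)%:R ^+ 2)^-1 <= (W%:R * 2 ^+ l)^-1 :> R.
      rewrite lef_pV2 ?posrE ?mulr_gt0 ?exprn_gt0 //.
      rewrite expr2 ler_pM ?ler0n ?(ltW p0) //; exact: le_trans rl.
    rewrite (_ : 16 * _ * _ / _ / _ * _ =
      r%:R ^+ 2 * (4 * V ^+ 2 * (W%:R * 2 ^+ l)^-1 * (4 * energy f))); last first.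
      by field; rewrite !gt_eqF.
    rewrite ler_wpM2l ?sqr_ge0 //.
    rewrite (_ : (2 * V / _) ^+ 2 = 4 * V ^+ 2 * ((rho l)%:R ^+ 2)^-1); last first.
      by field; rewrite gt_eqF.
    apply: ler_pM.
    - by rewrite mulr_ge0 ?invr_ge0 ?sqr_ge0 // mulr_ge0 ?sqr_ge0.
    - exact: energy_ge0.
    - by rewrite ler_wpM2l // mulr_ge0 ?sqr_ge0.
    - exact: energy_sub_avg.
  rewrite sumr_const card_ord -[leLHS]mulr_natl -mulr_suml -mulr_sumr.
  apply: (@le_trans _ _ (N%:R * (16 * r%:R ^+ 2 * V ^+ 2 / W%:R * 2 * energy f))).
    rewrite ler_wpM2l // ler_wpM2r // ler_wpM2l ?sum_half_pow_le2 //.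
    by rewrite mulr_ge0 ?invr_ge0 ?ler0n // mulr_ge0 ?sqr_ge0 // mulr_ge0 ?sqr_ge0.
  rewrite (_ : _ * _ = c / W%:R * energy f); last by rewrite /c; field; rewrite gt_eqF.
  by rewrite ler_piMl // ler_pdivrMr // mul1r ltW.
(* The square of a sum of three is at most three times the sum of squares: [3 * (256 + 320) = 1728],
   and [3 * 1 = 3]. *)
apply: (@le_trans _ _ (\sum_x (3 * P1 x ^+ 2 + 3 * P2 x ^+ 2 + 3 * P3 x ^+ 2))).
  apply: ler_sum => x _; rewrite split3.
  have := sqr_ge0 (P1 x - P2 x); have := sqr_ge0 (P2 x - P3 x).
  have := sqr_ge0 (P1 x - P3 x); nra.
rewrite !big_split -!mulr_sumr /=; nra.
Qed.

End FiniteMaximal.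

(** * Many primes in a dyadic interval *)

Section PrimeFamilies.
Local Open Scope nat_scope.

Lemma expn2_le_central_bin n : 2 ^ n <= 'C(n.*2, n).
Proof.
elim: n => // n IH; rewrite doubleS expnS binS mul2n -addnn.
by rewrite leq_add // (leq_trans IH) // ?binS ?leq_addl //; case: n {IH} => // n;
  rewrite binS leq_addr.
Qed.

(** The added terms vanish; this brings Legendre's sums for the two factorials to a common range. *)
Lemma sum_divn_pow_widen p n m : 1 < p -> n <= m ->
  \sum_(1 <= k < n.+1) n %/ p ^ k = \sum_(1 <= k < m.+1) n %/ p ^ k.
Proof.
move=> p1 le_nm; rewrite [RHS](big_cat_nat _ (n := n.+1)) //=.
rewrite [X in _ + X]big1_seq ?addn0 // => k /andP[_].
rewrite mem_index_iota => /andP[lt_nk _]; apply: divn_small.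
exact: leq_trans lt_nk (ltnW (ltn_expl k p1)).
Qed.

(** By Legendre's formula each [k] contributes the floor of [2n / p^k] minus twice that of
    [n / p^k], which is 0 or 1, and 0 once [p^k > 2n]. The exponent is therefore at most the
    logarithm of [2n] to base [p]. *)
Lemma pfactor_central_bin p n : prime p -> 0 < n ->
  p ^ logn p 'C(n.*2, n) <= n.*2.
Proof.
move=> pr_p n0; have p1 := prime_gt1 pr_p.
have n20 : 0 < n.*2 by rewrite double_gt0.
apply: leq_trans (trunc_logP p1 n20); rewrite leq_exp2l //.
set L := trunc_log p n.*2.
have leL : L <= n.*2.
  by apply: leq_trans (trunc_logP p1 n20); exact: ltnW (ltn_expl _ p1).
have le_n : n <= n.*2 by rewrite -addnn leq_addr.
have := congr1 (logn p) (bin_fact le_n).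
have -> : n.*2 - n = n by rewrite -addnn addnK.
rewrite !lognM ?muln_gt0 ?fact_gt0 ?bin_gt0 //.
rewrite !logn_fact // (sum_divn_pow_widen p1 le_n) => E.
rewrite -(leq_add2r (\sum_(1 <= k < n.*2.+1) n %/ p ^ k +
  \sum_(1 <= k < n.*2.+1) n %/ p ^ k)) E -big_split /=.
have -> : L = \sum_(1 <= k < n.*2.+1) (k <= L).
  rewrite (big_cat_nat _ (n := L.+1)) //= [X in _ + X]big1_seq ?addn0.
    rewrite (eq_big_nat _ _ (F2 := fun=> 1)) => [|k /andP[_]]; last first.
      by rewrite ltnS => ->.
    by rewrite sum_nat_const_nat subn1 muln1.
  by move=> k /andP[_]; rewrite mem_index_iota => /andP[lt_Lk _]; rewrite leqNgt lt_Lk.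
rewrite -big_split /=; apply: leq_sum => k _.
have pk : 0 < p ^ k by rewrite expn_gt0 prime_gt0.
case: (leqP k L) => [_|lt_Lk].
  rewrite -ltnS ltn_divLR //; have := ltn_ceil n pk; lia.
rewrite divn_small // (leq_trans (trunc_log_ltn n.*2 p1)) // leq_exp2l //.
Qed.

Lemma primes_central_bin n : 0 < n -> n.*2 ^ size (primes 'C(n.*2, n)) >= 2 ^ n.
Proof.
move=> n0; apply: leq_trans (expn2_le_central_bin n) _.
have C0 : 0 < 'C(n.*2, n) by rewrite bin_gt0 -addnn leq_addr.
rewrite {1}(prod_prime_decomp C0) prime_decompE big_map /=.
have : {subset primes 'C(n.*2, n) <= prime}.
  by move=> p; rewrite mem_primes => /andP[].
elim: (primes _) => [|p s IH] sub; first by rewrite big_nil.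
rewrite big_cons expnS leq_mul ?IH //.
  by apply: pfactor_central_bin => //; apply: sub; rewrite mem_head.
by move=> q sq; apply: sub; rewrite in_cons sq orbT.
Qed.

Lemma primes_central_bin_le p n : p \in primes 'C(n.*2, n) -> p <= n.*2.
Proof.
rewrite mem_primes => /and3P[pr_p _ dvd_p].
have le_n : n <= n.*2 by rewrite -addnn leq_addr.
have : p %| n.*2`! by rewrite -(bin_fact le_n) dvdn_mulr.
elim: (n.*2) => [|m IH]; first by rewrite dvdn1 => /eqP p1; rewrite p1 in pr_p.
rewrite factS Euclid_dvdM // => /orP[/dvdn_leq->//|/IH]; exact: leqW.
Qed.

Lemma size_fibers (T : eqType) (f : T -> nat) m (s : seq T) :
  {in s, forall x, f x < m} -> size s = \sum_(i < m) count (fun x => f x == i) s.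
Proof.
elim: s => [|x s IH] lt_m; first by rewrite big1.
rewrite /= IH => [|y sy]; last by apply: lt_m; rewrite in_cons sy orbT.
rewrite big_split /= -add1n; congr (_ + _).
have lt_x := lt_m x (mem_head _ _).
rewrite (bigD1 (Ordinal lt_x)) //= eqxx big1 ?addn0 // => i.
by rewrite -val_eqE /= eq_sym => /negPf ->.
Qed.

Lemma dyadic_primes t N : t.+1 * N * t.+1 <= 2 ^ t -> 0 < N ->
  exists i (s : seq nat), [/\ i <= t.+1, size s = N, uniq s &
    {in s, forall p, prime p /\ 2 ^ i <= p < 2 ^ i.+1}].
Proof.
move=> lt_t N0; pose n := 2 ^ t; pose P := primes 'C(n.*2, n).
have n2E : n.*2 = 2 ^ t.+1 by rewrite -mul2n expnS.
have szP : n <= t.+1 * size P.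
  rewrite -(@leq_exp2l 2) // expnM -n2E.
  by apply: primes_central_bin; rewrite expn_gt0.
have P_prime p : p \in P -> prime p by rewrite mem_primes => /andP[].
have P_le p : p \in P -> trunc_log 2 p < t.+2.
  move=> Pp; rewrite ltnS -(@leq_exp2l 2) // -n2E.
  apply: leq_trans (primes_central_bin_le Pp).
  by apply: trunc_logP => //; exact/prime_gt0/P_prime.
have szE := size_fibers P_le.
have [[i le_Ni]|none] : (exists i : 'I_t.+2,
    N <= count (fun p => trunc_log 2 p == i) P) \/
    forall i : 'I_t.+2, count (fun p => trunc_log 2 p == i) P < N.
  case: (boolP [exists i : 'I_t.+2, N <= count (fun p => trunc_log 2 p == i) P]).
    by move=> /existsP; left.
  by rewrite negb_exists => /forallP H; right => i; rewrite ltnNge H.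
- exists i, (take N [seq p <- P | trunc_log 2 p == i]); split.
  + by rewrite -ltnS.
  + by rewrite size_take size_filter; case: ltngtP le_Ni.
  + by rewrite take_uniq // filter_uniq // primes_uniq.
  + move=> p /mem_take; rewrite mem_filter => /andP[/eqP <- /P_prime pr_p].
    by split=> //; exact/trunc_log_bounds/prime_gt0.
(* The interval [[1, 2)] has no prime, so [t.+1] of the [t.+2] intervals count. *)
- have P0 : 0 < count (fun p => trunc_log 2 p == 0) P -> False.
    rewrite -has_count => /hasP[p /P_prime pr_p /eqP E].
    have := trunc_log_bounds (isT : 1 < 2) (prime_gt0 pr_p).
    by rewrite E; case: p pr_p E => [|[|[|p]]].
  have : size P <= t.+1 * N.-1.
    rewrite szE big_ord_recl /= (_ : count _ P = 0) ?add0n; last first.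
      by case: (count _ P) P0 => // ? /(_ isT).
    rewrite -[X in _ <= X * _](card_ord t.+1) -sum_nat_const; apply: leq_sum => j _.
    by have := none (lift ord0 j); case: (N) N0.
  rewrite /n in szP; move: szP lt_t N0; clear; set x := 2 ^ t; nia.
Qed.

Lemma coprime_family N : 0 < N -> exists U (u : 'I_N -> nat),
  [/\ 0 < U, U <= N ^ 26, injective u, forall i, U <= u i <= 2 * U &
    forall i j, i != j -> coprime (u i) (u j)].
Proof.
case: (leqP N 1) => [le_N1 N0|lt_1N N0].
  exists 1, (fun=> 1); split=> //; first by rewrite expn_gt0 N0.
  by move=> i j _; apply: val_inj; case: i j => i lt_i [j lt_j] /=; lia.
(* The bound [2^s <= N^2] turns [2^t.+1 = 2^(13 * s)] into at most [N^26], while [2 * 13^2 < 2^10]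
   leaves room for the pigeonhole hypothesis. *)
pose s := up_log 2 N; pose t := 13 * s - 1.
have N_le : N <= 2 ^ s := up_logP N (isT : 1 < 2).
have s0 : 0 < s by rewrite up_log_gt0.
have tS : t.+1 = 13 * s by rewrite /t; lia.
have le_N2 : 2 ^ s <= N ^ 2.
  have : 2 ^ s.-1 < N by apply: up_log_gtn => //; rewrite N0.
  by rewrite -(prednK s0) expnS -mulnn /=; nia.
have [|//|i [l [le_i sz uniq_l lP]]] := @dyadic_primes t N.
  rewrite -(leq_pmul2l (isT : 0 < 2)) -expnS tS expnM.
  have le_s : s <= 2 ^ s by exact: ltnW (ltn_expl _ _).
  have -> : (2 ^ 13) ^ s = (2 ^ s) ^ 3 * (2 ^ 10) ^ s.
    by rewrite -!expnM -expnD; congr (2 ^ _); lia.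
  have : 2 ^ 10 <= (2 ^ 10) ^ s by rewrite -{1}(expn1 (2 ^ 10)) leq_exp2l.
  move: N_le le_s; set x := 2 ^ s; set y := (_ ^ s) => N_le le_s le_y.
  have : s * N * s <= x ^ 3.
    by rewrite !expnS expn0 muln1 -mulnA (mulnC N) leq_mul // leq_mul.
  have : 2 ^ 10 = 1024 by []; move: le_y; set z := 2 ^ 10 => le_y zE.
  move: (x ^ 3) => w; nia.
have mem (k : 'I_N) : nth 0 l k \in l by rewrite mem_nth ?sz.
exists (2 ^ i), (fun k : 'I_N => nth 0 l k); split.
- by rewrite expn_gt0.
- apply: leq_trans (_ : 2 ^ (13 * s) <= _); first by rewrite leq_exp2l // -tS.
  by rewrite mulnC expnM (_ : 26 = 2 * 13) // [N ^ _]expnM leq_exp2r.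
- move=> j k /eqP; rewrite nth_uniq ?sz // => /eqP; exact: val_inj.
- by move=> k; have [_ /andP[-> /ltnW]] := lP _ (mem k); rewrite -expnS.
- move=> j k ne_jk; have [pr_j _] := lP _ (mem j); have [pr_k _] := lP _ (mem k).
  by rewrite prime_coprime // dvdn_prime2 // nth_uniq ?sz.
Qed.

End PrimeFamilies.

(** * From bump functions on the plane to weights on finite groups *)

Section BumpWeights.
Variables (R : realType) (phi : R -> R).
Hypothesis bump : bump_function phi.

Lemma bump_support : exists2 c : R, 0 < c & forall t, c < `|t| -> phi t = 0.
Proof.
have [_ /compact_bounded bnd] := bump.
have [M [_ HM]] := bnd.
exists (Num.max M 0 + 1); first by rewrite ltr_wpDl // le_max lexx orbT.
move=> t lt_t; apply/eqP; apply: contraTT lt_t => nz; rewrite -leNgt.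
apply: HM; last exact: subset_closure.
by rewrite (@le_lt_trans _ _ (Num.max M 0)) ?le_max ?lexx // ltrDl.
Qed.

Lemma bounded_of_support (f : R -> R) : continuous f ->
  (exists2 c, 0 < c & forall t, c < `|t| -> f t = 0) ->
  exists2 B, 0 <= B & forall t, `|f t| <= B.
Proof.
move=> cf [c c0 f0].
have cfn : {within `[- c, c], continuous (fun t => `|f t|)}.
  apply: continuous_subspaceT => t; apply: continuous_comp; first exact: cf.
  exact: norm_continuous.
have le_c : - c <= c by lra.
have [t0 _ ub] := EVT_max le_c cfn.
exists `|f t0| => // t; case: (leP `|t| c) => [le_t|/f0 ->]; last by rewrite normr0.
by apply: ub; rewrite in_itv /= -ler_norml.
Qed.

Lemma bump_continuous m : continuous (derive1n m phi).
Proof.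
move=> t; apply: differentiable_continuous; apply/derivable1_diffP.
by have [der _] := bump; exact: der.
Qed.

Lemma bump_bounded : exists2 B, 0 <= B & forall t, `|phi t| <= B.
Proof.
apply: bounded_of_support bump_support; exact: (@bump_continuous 0).
Qed.

(** The derivative is continuous and vanishes where [phi] is locally zero, hence is bounded; the
    mean value theorem concludes. *)
Lemma bump_lipschitz : exists2 L, 0 <= L &
  forall s t, `|phi s - phi t| <= L * `|s - t|.
Proof.
have [c c0 phi0] := bump_support.
have [L L0 leL] : exists2 L, 0 <= L & forall t, `|derive1n 1 phi t| <= L.
  apply: bounded_of_support; first exact: bump_continuous.
  exists c => // t lt_t; rewrite derive1n1 derive1E.
  rewrite (@near_eq_derive _ _ _ _ (cst 0)) ?derive_cst //.
  have op : \forall s \near t, c < `|s|.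
    have nc : `|s| @[s --> t] --> `|t| by exact: (@norm_continuous _ R t).
    exact: (cvgr_gt _ nc _ lt_t).
  by near=> s; apply: phi0; near: s.
exists L => // s t; wlog le_st : s t / s <= t.
  move=> H; case: (leP s t) => [/H //|/ltW /H]; by rewrite distrC (distrC t).
have der (x : R) : is_derive x 1 phi (derive1n 1 phi x).
  apply: DeriveDef; last by rewrite derive1n1 derive1E.
  by have [H _] := bump; have := H 0%N x.
have cst_phi : {within `[s, t], continuous phi}.
  exact: (continuous_subspaceT (@bump_continuous 0)).
have [x _ E] := MVT_segment le_st (fun (x : R) _ => der x) cst_phi.
by rewrite distrC E normrM (distrC s) ler_wpM2r.
Unshelve. all: by end_near. Qed.

(** [c] is an integer beyond the support radius, so the dilate vanishes from [rho k = c * 2^k] on.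
    As [2^-k = c / rho k], a bound on [phi] costs a factor [c] and a Lipschitz bound costs [c^2]. *)
Lemma bump_weights : exists (c : nat) (B V : R),
  [/\ (0 < c)%N, admissible_weights (fun k => c * 2 ^ k)%N
        (fun k i => dilate phi k (i%:R - (c * 2 ^ k)%:R)) B V &
      forall (k : nat) (t : R), (c * 2 ^ k)%:R <= `|t| -> dilate phi k t = 0].
Proof.
have [c0 c0_gt0 phi0] := bump_support.
have [B B0 leB] := bump_bounded; have [L L0 leL] := bump_lipschitz.
pose c := (Num.bound c0).+1.
have lt_c : c0 < c%:R.
  by apply: lt_trans (archi_boundP (ltW c0_gt0)) _; rewrite ltr_nat.
have cR : c%:R != 0 :> R by rewrite pnatr_eq0.
have p0 k : (2 : R) ^+ k != 0 by rewrite expf_neq0 ?pnatr_eq0.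
have pgt k : 0 < (2 : R) ^+ k by rewrite exprn_gt0.
have dilE (k : nat) t : dilate phi k t = (2 ^+ k)^-1 * phi ((2 ^+ k)^-1 * t).
  by rewrite /dilate -exprz_inv -exprnP exprVn.
have far (k : nat) (t : R) : (c * 2 ^ k)%:R <= `|t| -> dilate phi k t = 0.
  move=> le_t; rewrite dilE phi0 ?mulr0 // normrM ger0_norm ?invr_ge0 ?(ltW (pgt k)) //.
  rewrite mulrC ltr_pdivlMr //; apply: lt_le_trans le_t.
  by rewrite natrM natrX ltr_pM2r.
exists c, (c%:R * B), (c%:R ^+ 2 * L); split=> //; split=> [k|k|k|k i|k i].
- by rewrite -{1}(mul1n (2 ^ k)%N) leq_mul2r orbT.
- by apply: far; rewrite sub0r normrN ger0_norm.
- by apply: far; rewrite mul2n -addnn natrD addrK ger0_norm.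
- rewrite dilE normrM ger0_norm ?invr_ge0 ?(ltW (pgt k)) //.
  rewrite (_ : _ / _ = (2 ^+ k)^-1 * B); last first.
    by rewrite natrM natrX; field; rewrite cR p0.
  by rewrite ler_wpM2l ?invr_ge0 ?(ltW (pgt k)).
- rewrite !dilE -mulrBr normrM ger0_norm ?invr_ge0 ?(ltW (pgt k)) //.
  rewrite (_ : _ / _ = (2 ^+ k)^-1 * (L * (2 ^+ k)^-1)); last first.
    by rewrite natrM natrX; field; rewrite cR p0.
  rewrite ler_wpM2l ?invr_ge0 ?(ltW (pgt k)) //.
  apply: le_trans (leL _ _) _; rewrite ler_wpM2l // -mulrBr normrM.
  rewrite ger0_norm ?invr_ge0 ?(ltW (pgt k)) // -natr1.
  by rewrite (_ : _ - _ - _ = 1) ?normr1 ?mulr1 //; ring.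
Qed.

End BumpWeights.

(** * Transference from finite tori to the plane *)

Section Transference.
Variables (R : realType) (rho : nat -> nat) (wt : nat -> nat -> R).
Local Notation Z2 := (int * int)%type.

Section Wrapping.
Variable d : nat.
(** Shifted by [d], the box [[-d, d]] becomes [[0, 2d]] and embeds modulo [M]; also [M >= 2], as
    ['Z_M] requires to have [M] elements. *)
Let M := d.*2.+2.

Definition wrap (z : Z2) : 'rV['Z_M]_2 :=
  \row_i (if i == 0 then z.1 else z.2)%:~R.

Definition unwrap (y : 'rV['Z_M]_2) : Z2 :=
  ((y 0 0 : nat)%:Z - d%:Z, (y 0 1 : nat)%:Z - d%:Z).

Lemma wrapD z z' : wrap (z + z') = wrap z + wrap z'.
Proof. by apply/rowP => i; rewrite !mxE; case: ifP => _; rewrite -intrD. Qed.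

Lemma wrapB z z' : wrap (z - z') = wrap z - wrap z'.
Proof. by apply/rowP => i; rewrite !mxE; case: ifP => _; rewrite -intrB. Qed.

Lemma wrapMn z n : wrap (z *+ n) = wrap z *+ n.
Proof.
elim: n => [|n IH]; last by rewrite !mulrSr wrapD IH.
by apply/rowP => i; rewrite !mxE; case: ifP.
Qed.

Lemma wrapK (z : Z2) : (`|z.1| <= d)%N -> (`|z.2| <= d)%N ->
  unwrap (wrap z + wrap (d%:Z, d%:Z)) = z.
Proof.
have val_wrap (a : int) : (`|a| <= d)%N ->
    (nat_of_ord (a%:~R + (d%:Z)%:~R : 'Z_M))%:Z - d%:Z = a.
  move=> le_a; rewrite -intrD.
  have [n En] : exists n : nat, a + d%:Z = n%:Z.
    by exists (absz (a + d%:Z)); rewrite gez0_abs //; lia.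
  rewrite En -pmulrn val_Zp_nat // modn_small; first by rewrite -En addrK.
  rewrite /M; lia.
move=> le1 le2; rewrite /unwrap !mxE /= !val_wrap //.
by case: (z).
Qed.

Lemma unwrap_inj : injective unwrap.
Proof.
move=> y y' [/addIr [E0] /addIr [E1]]; apply/rowP => i.
have [->|->] : i = 0 \/ i = 1.
  by case: i => [[|[|]]] // lt_i; [left|right]; exact/val_inj.
- exact: val_inj.
- exact: val_inj.
Qed.

End Wrapping.

(* Calderon's transference: finitely many points and finitely many averages only
   see a bounded box of the plane, which embeds in a large enough torus. *)
Lemma transference N (u : 'I_N -> nat) (P : nat -> Prop) (C : R) (g : Z2)
    (k : Z2 -> nat) (j : Z2 -> 'I_N) (X : seq Z2) :
  maximal_estimate rho wt u P C -> (forall x, P (k x)) -> uniq X ->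
  exists2 Y : seq Z2, uniq Y & forall f : Z2 -> R,
  \sum_(x <- X) wavg rho wt (g *+ u (j x)) (k x) f x ^+ 2 <=
    C * \sum_(y <- Y) f y ^+ 2.
Proof.
move=> est Pk uniqX.
pose pt x i := x + g *+ u (j x) *+ rho (k x) - g *+ u (j x) *+ i.
(* [pts] lists the points of [X] and all points where the averages evaluate [f]. *)
pose pts := X ++ flatten [seq [seq pt x i | i <- iota 0 (2 * rho (k x))] | x <- X].
pose d := (\sum_(p <- pts) (`|p.1| + `|p.2|))%N.
have in_box p : p \in pts -> (`|p.1| <= d)%N /\ (`|p.2| <= d)%N.
  move=> pP; have : (`|p.1| + `|p.2| <= d)%N by rewrite /d (big_rem p) //= leq_addr.
  lia.
pose tau z := wrap d z + wrap d (d%:Z, d%:Z).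
have tauK z : z \in pts -> unwrap (tau z) = z by move=> /in_box[]; exact: wrapK.
have X_pts x : x \in X -> x \in pts by rewrite mem_cat => ->.
pose G : finZmodType := 'rV['Z_d.*2.+2]_2.
(* [Y] is the image of the whole torus and does not depend on [f], so real and imaginary parts can
   share it. *)
exists (map (@unwrap d) (enum G)) => [|f].
  by rewrite map_inj_uniq ?enum_uniq //; exact: unwrap_inj.
pose f' (y : G) := f (unwrap y).
have avgE x : x \in X -> wavg rho wt (g *+ u (j x)) (k x) f x =
    wavg rho wt (wrap d g *+ u (j x) : G) (k x) f' (tau x).
  move=> xX; apply: eq_bigr => i _; congr (_ * _); rewrite /f'.
  have ptP : pt x i \in pts.
    rewrite mem_cat; apply/orP; right; apply/flattenP.
    exists [seq pt x i | i <- iota 0 (2 * rho (k x))]; first exact: map_f.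
    by apply: map_f; rewrite mem_iota add0n ltn_ord.
  rewrite -/(pt x i) -{1}(tauK _ ptP); congr (f (unwrap _)).
  by rewrite /tau /pt wrapB wrapD !wrapMn addrAC (addrAC (wrap d x)).
have := est G (wrap d g) (fun y => k (unwrap y)) (fun y => j (unwrap y)) f'
  (fun y => Pk _).
set S := (X in X <= _).
have -> : energy f' = \sum_(y <- map (@unwrap d) (enum G)) f y ^+ 2.
  by rewrite big_map /energy big_enum.
apply: le_trans.
pose h (y : G) := wavg rho wt (wrap d g *+ u (j (unwrap y)) : G) (k (unwrap y)) f' y ^+ 2.
have -> : \sum_(x <- X) wavg rho wt (g *+ u (j x)) (k x) f x ^+ 2 =
    \sum_(y <- map tau X) h y.
  rewrite big_map big_seq [RHS]big_seq; apply: eq_bigr => x xX.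
  by rewrite /h (tauK _ (X_pts _ xX)) avgE.
have uniq_tau : uniq (map tau X).
  rewrite map_inj_in_uniq // => x x' xX x'X E.
  by rewrite -(tauK _ (X_pts _ xX)) E tauK // X_pts.
rewrite (big_uniq _ uniq_tau) /S [leRHS](bigID (mem (map tau X))) /= lerDl.
by apply: sumr_ge0 => y _; exact: sqr_ge0.
Qed.

End Transference.

(** * Linearization of the supremum *)

Section SupLinearization.
Variable R : realType.

(** At each point a near-maximiser within a factor [1 - e] is chosen; the hypothesis bounds every
    finite sum for this choice, and [e] is then taken small. *)
Lemma esum_sup_le (T : choiceType) (I : Type) (P : I -> Prop) (i0 : I)
    (a : T -> I -> R) (c : R) : P i0 -> (forall x i, 0 <= a x i) ->
  (forall (s : T -> I) (X : seq T), (forall x, P (s x)) -> uniq X ->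
     \sum_(x <- X) a x (s x) ^+ 2 <= c) ->
  (\esum_(x in [set: T])
     (`|ereal_sup [set (a x i)%:E | i in P]| ^+ 2) <= c%:E)%E.
Proof.
move=> Pi0 a0 le_c.
pose S x := fine (ereal_sup [set (a x i)%:E | i in P]).
have SE x : ereal_sup [set (a x i)%:E | i in P] = (S x)%:E.
  rewrite /S fineK // fin_numE; apply/andP; split.
    apply/eqP => E; have := @ereal_sup_ubound _ [set (a x i)%:E | i in P] (a x i0)%:E.
    rewrite E leeNy_eq => H.
    by have /eqP := H (ex_intro2 _ _ i0 Pi0 erefl).
  (* The hypothesis on the one-point list [[:: x]] bounds each [a x i] by the square root of [c]. *)
  rewrite -ltey; apply: le_lt_trans (ltry (Num.sqrt c)).
  apply: ge_ereal_sup => _ [i Pi <-]; rewrite lee_fin.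
  rewrite -(ger0_norm (a0 x i)) -sqrtr_sqr ler_wsqrtr //.
  by have := le_c (fun=> i) [:: x] (fun=> Pi) isT; rewrite big_seq1.
have S_ge x i : P i -> a x i <= S x.
  by move=> Pi; rewrite -lee_fin -SE; apply: ereal_sup_ubound; exists i.
have S0 x : 0 <= S x := le_trans (a0 x i0) (S_ge x i0 Pi0).
have sqE x : (`|ereal_sup [set (a x i)%:E | i in P]| ^+ 2)%E = (S x ^+ 2)%:E.
  by rewrite SE EFin_expe /= ger0_norm.
have adherent (e : R) : 0 < e -> e < 1 ->
    exists s : T -> I, forall x, P (s x) /\ (1 - e) * S x <= a x (s x).
  move=> e0 e1; suff /choice[s sP] : forall x, exists i,
    P i /\ (1 - e) * S x <= a x i by exists s.
  move=> x; have := S0 x.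
  rewrite le_eqVlt => /orP[/eqP <-|Sx0]; first by exists i0; rewrite mulr0.
  have eS0 : 0 < e * S x by rewrite mulr_gt0.
  have finS : ereal_sup [set (a x i)%:E | i in P] \is a fin_num by rewrite SE.
  have [_ [i Pi <-]] := ub_ereal_sup_adherent eS0 finS.
  rewrite SE -EFinB lte_fin => /ltW lt_a; exists i; split=> //.
  by rewrite mulrBl mul1r.
apply: ge_ereal_sup => _ [X [finX _] <-].
rewrite fsbig_finite //; under eq_bigr do rewrite sqE.
rewrite sumEFin lee_fin; set Q := \sum_(x <- _) _.
have Q0 : 0 <= Q by apply: sumr_ge0 => x _; exact: sqr_ge0.
have leQ e : 0 < e -> e < 1 -> (1 - e) ^+ 2 * Q <= c.
  move=> e0 e1; have [s sP] := adherent e e0 e1.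
  apply: le_trans (le_c s (fset_set X) (fun x => (sP x).1) (fset_uniq _)).
  rewrite /Q mulr_sumr; apply: ler_sum => x _; rewrite -exprMn ler_sqr ?nnegrE //.
    by have [] := sP x.
  by rewrite mulr_ge0 // subr_ge0 ltW.
rewrite leNgt; apply/negP => lt_cQ.
have c0 : 0 <= c by have := le_c (fun=> i0) [::] (fun=> Pi0) isT; rewrite big_nil.
have Qgt : 0 < Q := le_lt_trans c0 lt_cQ.
(* With this [e], [(1 - e)^2 * Q >= Q - 2 * e * Q = (Q + c) / 2 > c]. *)
pose e := (Q - c) / (4 * Q).
have eE : e * (4 * Q) = Q - c by rewrite /e divfK // mulf_neq0 // gt_eqF.
have e0 : 0 < e by rewrite divr_gt0 ?subr_gt0 ?mulr_gt0.
have e1 : e < 1 by rewrite ltr_pdivrMr ?mulr_gt0 // mul1r; lra.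
have := leQ e e0 e1; nra.
Qed.

End SupLinearization.

(** * The maximal operator on the plane *)

Section PlanarOperator.
Variables (R : realType) (phi : R -> R) (c : nat) (B V : R).
Local Notation rho := (fun k : nat => c * 2 ^ k)%N.
Local Notation wt :=
  (fun k i : nat => dilate phi k (i%:R - (c * 2 ^ k)%:R)).
Hypothesis dilate0 :
  forall (k : nat) (t : R), (c * 2 ^ k)%:R <= `|t| -> dilate phi k t = 0.

Lemma sum_complex n (F H : 'I_n -> R) :
  \sum_i (F i +i* H i)%C = ((\sum_i F i) +i* (\sum_i H i))%C.
Proof.
elim: n F H => [|n IH] F H; first by rewrite !big_ord0.
by rewrite !big_ord_recl IH.
Qed.

(** [dilate0] confines the sum over all integers to the window, so it is genuinely finite; real
    [phi] lets the two components separate. *)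
Lemma average_wavg (k : nat) (v : int * int) (f : int * int -> R[i]) x :
  average phi k v f x =
    (wavg rho wt v k (fun y => complex.Re (f y)) x +i*
     wavg rho wt v k (fun y => complex.Im (f y)) x)%C.
Proof.
pose r := [seq (i%:Z - (rho k)%:Z) | i <- iota 0 (2 * rho k)].
rewrite /average (fsbigE r) //=.
- under eq_bigl do rewrite in_setT.
  have iotaE n : iota 0 n = index_iota 0 n by rewrite /index_iota subn0.
  rewrite big_map iotaE big_mkord /wavg -sum_complex; apply: eq_bigr => i _.
  have -> : x - v *~ (i%:Z - (rho k)%:Z) = x + v *+ rho k - v *+ i.
    by rewrite mulrzBr opprB -!pmulrn addrA.
  have -> : (i%:Z - (rho k)%:Z)%:~R = i%:R - (rho k)%:R :> R.
    by rewrite intrB -!pmulrn.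
  case: (f _) => a b /=; apply/eqP; rewrite eq_complex /=.
  by apply/andP; split; apply/eqP; ring.
- by rewrite map_inj_uniq ?iota_uniq // => i i' /addIr [].
- move=> n _ nr; rewrite dilate0 ?mulr0 // -intr_norm [leLHS]pmulrn.
  rewrite ler_int leNgt; apply: contra nr => lt_n.
  apply/mapP; exists (absz (n + (rho k)%:Z)); first by rewrite mem_iota; lia.
  lia.
Qed.

Lemma sqr_normc (z : R[i]) :
  ComplexField.Normc.normc z ^+ 2 = complex.Re z ^+ 2 + complex.Im z ^+ 2.
Proof. by case: z => a b /=; rewrite sqr_sqrtr // addr_ge0 ?sqr_ge0. Qed.

Lemma normc_ge0 (z : R[i]) : 0 <= ComplexField.Normc.normc z.
Proof. by case: z => a b /=; exact: sqrtr_ge0. Qed.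

(** The choice of scale and vector is made for the complex [f], but the estimate holds for every
    choice, so it applies to real and imaginary parts and the two bounds add without loss. *)
Lemma l2_opnorm_le (g : int * int) N (u : 'I_N -> nat) (P : nat -> Prop)
    (C r : R) (W : {fset int * int}) :
  (0 < N)%N -> 0 <= C -> 1 <= r -> maximal_estimate rho wt u P C ->
  (forall k : nat, r <= 2 ^+ k -> P k) ->
  (forall z, z \in W <-> exists i, z = g *+ u i) ->
  (l2_opnorm (maximal_operator phi W r) <= (Num.sqrt C)%:E)%E.
Proof.
move=> N0 C0 r1 est rP WP.
apply: ereal_inf_lbound; exists (Num.sqrt C) => //; split=> [|f fin_f].
  exact: sqrtr_ge0.
pose sq x := ((ComplexField.Normc.normc (f x)) ^+ 2)%:E.
have sqE x : (`|(ComplexField.Normc.normc (f x))%:E| ^+ 2)%E = sq x.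
  by rewrite /sq EFin_expe /= ger0_norm // normc_ge0.
have sumE : l2normC f = sqrte (\esum_(x in [set: int * int]) sq x).
  by rewrite /l2normC /l2norm; congr sqrte; apply: eq_esum => x _; exact: sqE.
have sum0 : (0 <= \esum_(x in [set: int * int]) sq x)%E.
  by apply: esum_ge0 => x _; rewrite lee_fin sqr_ge0.
rewrite sumE; move: fin_f; rewrite sumE.
have le_sum (Y : seq (int * int)) : uniq Y ->
    ((\sum_(y <- Y) ComplexField.Normc.normc (f y) ^+ 2)%:E <=
       \esum_(x in [set: int * int]) sq x)%E.
  move=> uniqY; apply: esum_ge; exists [set` Y]; first by split=> //; exact: finite_seq.
  by rewrite -fsbig_seq // sumEFin.
case: (\esum_(x in [set: int * int]) sq x)%E sum0 le_sum => [b|//|//].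
rewrite lee_fin => b0 le_b _.
have -> : ((Num.sqrt C)%:E * sqrte b%:E = sqrte (C * b)%:E)%E.
  by rewrite /= -EFinM sqrtrM.
rewrite /l2norm lee_sqrt ?lee_fin ?mulr_ge0 //.
pose adm (p : nat * 'I_N) := r <= 2 ^+ p.1.
pose a x (p : nat * 'I_N) :=
  ComplexField.Normc.normc (average phi p.1 (g *+ u p.2) f x).
have supE x : maximal_operator phi W r f x = ereal_sup [set (a x p)%:E | p in adm].
  rewrite /maximal_operator; congr ereal_sup; apply/seteqP; split=> y /=.
    move=> [k [v [le_r /WP[i ->] ->]]].
    (* As [r >= 1], a negative scale would violate [r <= 2^k]. *)
    have [n kE] : exists n : nat, k = n%:Z.
      case: k le_r => [n|n]; first by exists n.
      rewrite NegzE => /(le_trans r1); rewrite leNgt -exprz_inv -exprnP.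
      by rewrite exprn_ilt1 // invf_lt1 // ltr1n.
    by exists (n, i); rewrite /adm /a -?kE // exprnP -kE.
  move=> [[k i] adm_k <-]; exists k%:Z, (g *+ u i); split=> //.
  by apply/WP; exists i.
rewrite (eq_esum (b := fun x =>
  (`|ereal_sup [set (a x p)%:E | p in adm]| ^+ 2)%E)); last first.
  by move=> x _; rewrite supE.
have [p0 adm0] : exists p0, adm p0.
  exists (Num.bound r, Ordinal N0); have r0 : 0 <= r by lra.
  rewrite /adm /=; apply: le_trans (ltW (archi_boundP r0)) _.
  by rewrite -natrX ler_nat ltnW // ltn_expl.
apply: (@esum_sup_le R _ _ adm p0 a (C * b) adm0) => [x p|s X adm_s uniqX].
  exact: normc_ge0.
have [Y uniqY leY] := transference g (fun x => (s x).2) est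
  (fun x => rP _ (adm_s x)) uniqX.
apply: (@le_trans _ _ (C * \sum_(y <- Y) ComplexField.Normc.normc (f y) ^+ 2)).
  under [leLHS]eq_bigr do rewrite /a average_wavg sqr_normc /=.
  under [X in _ <= C * X]eq_bigr do rewrite sqr_normc.
  rewrite !big_split mulrDr lerD //; exact: leY.
by rewrite ler_wpM2l // -lee_fin le_b.
Qed.

End PlanarOperator.

(** * Choice of the vectors and of the constants *)

Lemma le1_powR_nat (R : realType) (N : nat) (e : R) :
  (0 < N)%N -> 0 <= e -> 1 <= N%:R `^ e.
Proof.
move=> N0 e0; rewrite [leLHS](_ : 1 = 1 `^ e); last by rewrite powR1.
by rewrite ge0_ler_powR ?nnegrE ?ler1n ?ler0n.
Qed.

Theorem corollary1p6 (R : realType) :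
  exists c1 c2 : R, [/\ 0 < c1, c1 < c2 &
  forall phi : R -> R, bump_function phi ->
  forall eps : R, 0 < eps ->
  exists Ceps C0 : R, exists C1 : R -> R,
  [/\ 0 < Ceps, 0 < C0, (forall A : R, 0 < C1 A) &
    forall (N : nat) (A : R), (0 < N)%N -> N%:R `^ C0 <= A ->
    exists V : {fset int * int},
      [/\ #|` V|%fset = N,
          (forall z : int * int, z \in V ->
             c1 * A <= euclid_norm R z /\ euclid_norm R z <= c2 * A) &
          (l2_opnorm (maximal_operator phi V (N%:R `^ C1 A))
             <= (Ceps * N%:R `^ eps)%:E)%E]]].
Proof.
exists (1 / 2), 2; split; [lra | lra |] => phi bump eps eps0.
have [c [B [L [c0 wtP far]]]] := bump_weights bump.
pose rho k := (c * 2 ^ k)%N.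
pose wt (k i : nat) := dilate phi k (i%:R - (c * 2 ^ k)%:R).
pose C := 1728 * B ^+ 2 + 3.
have C_gt0 : 0 < C by have := sqr_ge0 B; rewrite /C; lra.
(* The threshold [W] is imposed only for [N > 1]. It is fixed for each [N] before [A], so that [C1]
   can be built from it. *)
have /choice[W WP] : forall N, exists W : nat, (0 < N)%N ->
    exists U (u : 'I_N -> nat), [/\ (0 < U)%N, (U <= N ^ 26)%N, injective u,
      (forall i, U <= u i <= 2 * U)%N &
      maximal_estimate rho wt u (fun k => (1 < N)%N -> (W <= 2 ^ k)%N) C].
  move=> N; case: (posnP N) => [->|N0]; first by exists 0%N.
  have [U [u [U0 leU inj_u u_itv co]]] := coprime_family N0.
  have u_gt0 i : (0 < u i)%N.
    by have /andP[le_Uu _] := u_itv i; exact: leq_trans le_Uu.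
  case: (leqP N 1) => [le_N1|lt_1N].
    exists 0%N => _; exists U, u; split=> //.
    have N1 : N = 1%N by apply/eqP; rewrite eqn_leq le_N1.
    by case: _ / (esym N1) u {inj_u u_itv co u_gt0 leU} => u;
      exact: (maximal_estimate1 wtP).
  have [W WP] := maximal_estimate_coprime wtP u_gt0 co.
  exists W => _; exists U, u; split=> // G g k j f leW.
  by apply: WP => x; exact: leW.
(* [C1] depends on [A] but not on [N]. Since [N <= N^26 <= A], only finitely many [N] occur for a
   given [A], and the sum dominates all their thresholds. *)
pose n1 (A : R) := (\sum_(N < (Num.truncn A).+1) W N).+1.
exists (Num.sqrt C), 26%:R, (fun A => (n1 A)%:R); split.
- by rewrite sqrtr_gt0.
- by rewrite ltr0n.
- by move=> A; rewrite ltr0n.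
move=> N A N0; rewrite powR_mulrn // => le_A.
have [U [u [U0 leU inj_u u_itv est]]] := WP N N0.
have le_UA : U%:R <= A by apply: le_trans le_A; rewrite -natrX ler_nat.
have UR0 : 0 < U%:R :> R by rewrite ltr0n.
have A0 : 0 <= A by apply: le_trans le_UA.
(* As [U <= A], the floor [g] is at least 1 and [g * U] lies in [[A / 2, A]]; with [u i] in
   [[U, 2U]] the lengths lie in [[A / 2, 2A]]. *)
pose g := Num.truncn (A / U%:R).
have AU0 : 0 <= A / U%:R by rewrite divr_ge0.
have g0 : (0 < g)%N by rewrite truncn_gt0 ler_pdivlMr // mul1r.
have gU_le : g%:R * U%:R <= A.
  by rewrite -ler_pdivlMr // truncn_le.
have gU_ge : A <= 2 * (g%:R * U%:R).
  rewrite mulrA -ler_pdivrMr //; apply: le_trans (ltW (truncnS_gt _)) _.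
  by rewrite -natrM ler_nat -/g; lia.
pose v i : int * int := (g%:Z, 0) *+ u i.
have vE i : v i = ((g * u i)%:Z, 0).
  rewrite /v; elim: (u i) => [|n IH]; first by rewrite muln0.
  by rewrite mulrSr IH mulnS addnC; congr pair; rewrite addr0.
exists [fset v i | i in 'I_N]%fset; split.
- rewrite card_imfset /= ?size_enum_ord // => i j.
  by rewrite !vE => -[/eqP]; rewrite eqn_mul2l eqn0Ngt g0 => /eqP /inj_u.
- move=> _ /imfsetP[i _ ->]; rewrite vE /euclid_norm /= expr0n addr0 sqrtr_sqr.
  rewrite -pmulrn ger0_norm // natrM.
  have /andP[le_Uu le_uU] := u_itv i.
  have leR1 : U%:R <= (u i)%:R :> R by rewrite ler_nat.
  have leR2 : (u i)%:R <= 2 * U%:R :> R by rewrite -natrM ler_nat.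
  have gR : 0 <= g%:R :> R by rewrite ler0n.
  by split; nra.
- apply: (@le_trans _ _ (Num.sqrt C)%:E); last first.
    rewrite lee_fin ler_peMr ?sqrtr_ge0 //.
    by apply: le1_powR_nat => //; exact: ltW.
  apply: (l2_opnorm_le far N0 (ltW C_gt0) _ est).
  + by apply: le1_powR_nat.
  + move=> k; rewrite powR_mulrn // -!natrX ler_nat => le_k lt_1N.
    apply: leq_trans le_k.
    have lt_N : (N < (Num.truncn A).+1)%N.
      rewrite ltnS truncn_ge_nat //; apply: le_trans le_A.
      by rewrite -natrX ler_nat -{1}(expn1 N) leq_pexp2l.
    have le_W : (W N <= n1 A)%N.
      by rewrite /n1 (bigD1 (Ordinal lt_N)) //= leqW // leq_addr.
    (* The chain is [W N <= n1 A <= 2^(n1 A) <= N^(n1 A)], the last step by [N >= 2]. *)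
    apply: leq_trans le_W _; apply: leq_trans (ltnW (ltn_expl _ (isT : (1 < 2)%N))) _.
    by rewrite leq_exp2r.
  + move=> z; split=> [/imfsetP[i _ ->]|[i ->]]; first by exists i.
    by apply/imfsetP; exists i.
Qed.
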